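(* (a) An elementary finite-dimensional $k$-algebra satisfies condition (F) if and only if it is isomorphic to $k(G,\mathcal D,\rho)$ for some triple $(G,\mathcal D,\rho)$. (b) The triple is unique up to isomorphism: if $k(G,\mathcal D,\rho)\cong k(G',\mathcal D',\rho')$ as $k$-algebras, then there is an isomorphism of quivers $\varphi:G\to G'$ with $\varphi(\mathcal D)=\mathcal D'$ and $\rho'(\varphi(d))=\varphi(\rho(d))$ for all $d\in\mathcal D$.
   Context: $k$ is a field. A finite-dimensional $k$-algebra $\Lambda$ with Jacobson radical $\mathbf r$ is elementary if $\Lambda/\mathbf r$ is isomorphic to a finite direct product of copies of $k$. Condition (F): the radical of each indecomposable finitely generated projective left module is either projective or simple. For a finite quiver $H$ (vertex set $v(H)$, arrow set $a(H)$), $kH$ is its path algebra, with $\beta\alpha$ denoting the path ''first $\alpha$, then $\beta$''; $s,t$ denote start/terminal vertices; a sink is a vertex at which no arrow starts; $k[H,X]=kH/\langle X\rangle$. A triple $(G,\mathcal D,\rho)$ consists of a finite quiver $G$ without oriented cycles, a subset $\mathcal D\subseteq v(G)$ consisting of sinks of $G$, and a function $\rho:\mathcal D\to v(G)$ such that every sink of $G$ in $\operatorname{Im}\rho$ belongs to $\mathcal D$. Its algebra $k(G,\mathcal D,\rho)=k[H,\rho(H)]$, where $v(H)=v(G)$, $a(H)=a(G)\cup\{\alpha_d:d\to\rho(d)\mid d\in\mathcal D\}$ (one new arrow per $d$), and $\rho(H)=\{\beta\alpha_d\mid\beta\in a(H),\ d\in\mathcal D,\ s(\beta)=\rho(d)\}$.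 *)

(* Defs.v *)
From HB Require Import structures.
From mathcomp Require Import all_boot all_algebra all_field.
Set Implicit Arguments. Unset Strict Implicit. Unset Printing Implicit Defensive.
Import GRing.Theory.
Local Open Scope ring_scope.

Section Modules.
Variable L : pzRingType.

Definition submod (P : lmodType L) (S : P -> Prop) : Prop :=
  S 0 /\ (forall x y, S x -> S y -> S (x + y)) /\ (forall (a : L) x, S x -> S (a *: x)).

Definition maxsub (P : lmodType L) (S : P -> Prop) : Prop :=
  submod S /\ (exists x, ~ S x) /\
  forall T : P -> Prop, submod T -> (forall x, S x -> T x) ->
     (forall x, T x) \/ (forall x, T x -> S x).

Definition rad (P : lmodType L) : P -> Prop :=
  fun x => forall S : P -> Prop, maxsub S -> S x.

Definition fin_gen (P : lmodType L) : Prop :=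
  exists s : seq P, forall m : P,
    exists c : 'I_(size s) -> L, m = \sum_(i < size s) c i *: s`_i.

Definition projective (P : lmodType L) : Prop :=
  forall (N N' : lmodType L) (g : {linear N -> N'}) (f : {linear P -> N'}),
    (forall y, exists x, g x = y) ->
    exists h : {linear P -> N}, forall x, g (h x) = f x.

Definition indecomposable (P : lmodType L) : Prop :=
  (exists x : P, x != 0) /\
  forall A B : P -> Prop, submod A -> submod B ->
    (forall x, A x -> B x -> x = 0) ->
    (forall x, exists a b, A a /\ B b /\ x = a + b) ->
    (forall x, A x -> x = 0) \/ (forall x, B x -> x = 0).

Definition simple_sub (P : lmodType L) (S : P -> Prop) : Prop :=
  submod S /\ (exists x, S x /\ x != 0) /\
  forall T : P -> Prop, submod T -> (forall x, T x -> S x) ->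
     (forall x, T x -> x = 0) \/ (forall x, S x -> T x).

Definition proj_sub (P : lmodType L) (S : P -> Prop) : Prop :=
  exists (Q : lmodType L) (j : {linear Q -> P}),
    injective j /\ projective Q /\ forall y, S y <-> exists x, y = j x.

End Modules.

Section Algebras.
Variable k : fieldType.
Variable L : falgType k.

Definition jrad : L -> Prop := @rad L (L^o).

(* elementary: L / jrad L is isomorphic (as k-algebra) to k^n, i.e. there is a
   surjective k-algebra morphism L -> k^n (componentwise f i) with kernel jrad *)
Definition elementary : Prop :=
  exists (n : nat) (f : 'I_n -> L -> k),
    (forall i (a : k) (x y : L), f i (a *: x + y) = a * f i x + f i y) /\
    (forall i (x y : L), f i (x * y) = f i x * f i y) /\
    (forall i, f i 1 = 1) /\
    (forall c : 'I_n -> k, exists x : L, forall i, f i x = c i) /\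
    (forall x : L, (forall i, f i x = 0) <-> jrad x).

Definition condF : Prop :=
  forall P : lmodType L, fin_gen P -> projective P -> indecomposable P ->
    proj_sub (rad (P := P)) \/ simple_sub (rad (P := P)).
End Algebras.

Record quiver := Quiver {
  nv : nat; na : nat;
  qsrc : 'I_na -> 'I_nv;
  qtgt : 'I_na -> 'I_nv }.

(* paths of G: start vertex + sequence of arrows in order of traversal *)
Definition gpath_ok (G : quiver) (v : 'I_(nv G)) (s : seq 'I_(na G)) : bool :=
  if s is a :: s' then (qsrc a == v) && path (fun a b => qtgt a == qsrc b) a s'
  else true.
Definition gend (G : quiver) (v : 'I_(nv G)) (s : seq 'I_(na G)) : 'I_(nv G) :=
  last v [seq qtgt a | a <- s].

Definition acyclic (G : quiver) : Prop :=
  forall (v : 'I_(nv G)) (s : seq 'I_(na G)), gpath_ok v s -> s != [::] -> gend v s != v.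

Definition sink (G : quiver) (v : 'I_(nv G)) : bool := [forall a : 'I_(na G), qsrc a != v].

Record triple := Triple {
  tG : quiver;
  tD : {set 'I_(nv tG)};
  trho : 'I_(nv tG) -> 'I_(nv tG) (* only its values on tD matter *) }.
Arguments trho : clear implicits.

Definition triple_ok (T : triple) : Prop :=
  acyclic (tG T) /\
  (forall d, d \in tD T -> sink d) /\
  (forall d, d \in tD T -> sink (trho T d) -> trho T d \in tD T).

(* The quiver H: arrows are a(G) (inl) plus one arrow alpha_d : d -> rho d
   (inr d) for each d in D. *)
Section PathAlg.
Variable T : triple.
Local Notation G := (tG T).
Definition harrow := ('I_(na G) + 'I_(nv G))%type.
Definition hvalid (x : harrow) : bool :=
  match x with inl _ => true | inr d => d \in tD T end.
Definition hsrc (x : harrow) : 'I_(nv G) :=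
  match x with inl a => qsrc a | inr d => d end.
Definition htgt (x : harrow) : 'I_(nv G) :=
  match x with inl a => qtgt a | inr d => trho T d end.

(* a path of H: (start vertex, arrows in order of traversal) *)
Definition hpath := ('I_(nv G) * seq harrow)%type.
Definition hpath_ok (p : hpath) : bool :=
  all hvalid p.2 &&
  (if p.2 is a :: s' then (hsrc a == p.1) && path (fun a b => htgt a == hsrc b) a s'
   else true).
Definition hstart (p : hpath) := p.1.
Definition hend (p : hpath) : 'I_(nv G) := last p.1 [seq htgt a | a <- p.2].

(* paths not lying in the ideal generated by rho(H) = { beta alpha_d }:
   i.e. no new arrow alpha_d is followed by another arrow *)
Definition nonlast (s : seq harrow) : seq harrow :=
  if s is a :: s' then belast a s' else [::].
Definition allowed (p : hpath) : bool :=
  hpath_ok p && all (fun x => if x is inl _ then true else false) (nonlast p.2).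

(* "p after q" (written p q in the paper's convention) *)
Definition hcat (p q : hpath) : hpath := (q.1, q.2 ++ p.2).

(* L is isomorphic, as a k-algebra, to k(G,D,rho) = kH/<rho(H)>: L has a
   k-basis indexed by the paths of H outside the monomial ideal <rho(H)>
   (the standard basis of this monomial algebra), multiplying as in the
   path algebra: b p * b q = b (p q) if q ends where p starts and p q is not
   in the ideal, and 0 otherwise. *)
Definition iso_kT (k : fieldType) (L : falgType k) : Prop :=
  exists (b : hpath -> L) (ps : seq hpath),
    uniq ps /\ (forall p, (p \in ps) = allowed p) /\
    basis_of fullv [seq b p | p <- ps] /\
    (forall p q, allowed p -> allowed q ->
       b p * b q = if (hend q == hstart p) && allowed (hcat p q)
                   then b (hcat p q) else 0).
End PathAlg.

Definition triple_iso (T T' : triple) : Prop :=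
  exists (phv : 'I_(nv (tG T)) -> 'I_(nv (tG T')))
         (pha : 'I_(na (tG T)) -> 'I_(na (tG T'))),
    bijective phv /\ bijective pha /\
    (forall a, qsrc (pha a) = phv (qsrc a)) /\
    (forall a, qtgt (pha a) = phv (qtgt a)) /\
    [set phv d | d in tD T] = tD T' /\
    (forall d, d \in tD T -> trho T' (phv d) = phv (trho T d)).

(* Main.v *)
Require Import Defs.
From HB Require Import structures.
From mathcomp Require Import all_boot all_algebra all_field.
From mathcomp Require Import boolp.

(** Fix characters [f_v : L -> k], orthogonal idempotents [e_v] with sum [1], and
    the nilpotent ideal [J], the common kernel of the [f_v].  In a minimal family of
    generators [x_i = e_(v_i) x_i] of a module every relation has coefficients in
    [J]; if the module is projective, nilpotence of [J] kills these relations, so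
    the module is the direct sum of the [L x_i], with [L x_i] isomorphic to
    [L e_(v_i)].  Applied to [J e_v] this gives the arrows of [G] out of [v]; the
    vertices for which [J e_v] is not projective, hence simple, form [D], and an
    element spanning [J e_v] is the new arrow at [v].  Paths are then linearly
    independent because arrows can be cancelled on the right, and [G] is acyclic
    because the dimension of [L e_v] drops along arrows.

    Conversely, an indecomposable projective module over [k(G,D,rho)] is some
    [L e_v], whose radical is read off the path basis.

    For uniqueness, the characters of [L] recover the vertices, and
    [dim (J^2 + e_w J e_v) - dim J^2] counts the arrows from [v] to [w].  Finally
    [v] lies in [D] iff [J^2 e_v] is contained in [J^3] and some arrow out of [v]
    ends at a vertex which is not a sink of the full quiver [H]. *)

Set Implicit Arguments. Unset Strict Implicit. Unset Printing Implicit Defensive.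
Import GRing.Theory.
Local Open Scope ring_scope.

(** * Summands of free modules *)

Section ProjectiveModules.
Variable L : pzRingType.

Definition combo (I : finType) (M : lmodType L) (m : I -> M)
  (c : {ffun I -> L^o}) : M := \sum_i (c i : L) *: m i.

Fact combo_is_linear (I : finType) (M : lmodType L) (m : I -> M) :
  linear (combo m).
Proof.
move=> a x y; rewrite /combo scaler_sumr -big_split; apply: eq_bigr => i _ /=.
by rewrite !ffunE scalerDl scalerA.
Qed.

HB.instance Definition _ (I : finType) (M : lmodType L) (m : I -> M) :=
  GRing.isLinear.Build L {ffun I -> L^o} M _ (combo m) (combo_is_linear m).

Section Pmod.
Variables (I : finType) (eps : I -> L).

(* the direct sum of the [L eps_i] for idempotents [eps_i], inside a free module *)
Definition pmod_pred : pred {ffun I -> L^o} :=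
  fun c => [forall i, (c i : L) * eps i == c i].

Fact pmod_closed : submod_closed pmod_pred.
Proof.
split; first by apply/forallP => i; rewrite !ffunE mul0r.
move=> a x y /forallP hx /forallP hy; apply/forallP => i; rewrite !ffunE.
by rewrite mulrDl -[X in X + _]mulrA (eqP (hx i)) (eqP (hy i)).
Qed.

HB.instance Definition _ :=
  GRing.isSubmodClosed.Build L {ffun I -> L^o} pmod_pred pmod_closed.

Record pmod := Pmod { pmod_val : {ffun I -> L^o}; _ : pmod_pred pmod_val }.

HB.instance Definition _ := [isSub for pmod_val].
HB.instance Definition _ := [Choice of pmod by <:].
HB.instance Definition _ := [SubChoice_isSubZmodule of pmod by <:].
HB.instance Definition _ := [SubZmodule_isSubLmodule of pmod by <:].

Lemma pmodP (c : pmod) i : (val c i : L) * eps i = val c i.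
Proof. by apply/eqP; exact: (forallP (valP c) i). Qed.

Hypothesis eps_idem : forall i, eps i * eps i = eps i.

Fact pmod_gen_subproof i :
  pmod_pred [ffun j => if j == i then eps i : L^o else 0].
Proof.
apply/forallP => j; rewrite ffunE.
by have [->|_] := eqVneq j i; rewrite ?eps_idem ?mul0r.
Qed.

Definition pmod_gen i : pmod := Pmod (pmod_gen_subproof i).

Lemma pmod_genE (c : pmod) : c = \sum_i (val c i : L) *: pmod_gen i.
Proof.
apply: val_inj; rewrite raddf_sum /=; apply/ffunP => i.
rewrite sum_ffunE (bigD1 i) //= !ffunE eqxx big1 ?addr0.
  exact/esym/pmodP.
by move=> j ji; rewrite !ffunE eq_sym (negPf ji) scaler0.
Qed.

(** The lift is the restriction of a map on the whole free module, sending the [i]-th unit vector to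
    any preimage of [f (pmod_gen i)]. *)
Lemma pmod_projective : projective pmod.
Proof.
move=> N N' g f surj.
have /choice[n gn] : forall i, exists n, g n = f (pmod_gen i) by [].
exists (combo n \o val) => c /=; rewrite [in RHS](pmod_genE c) /combo !linear_sum.
by apply: eq_bigr => i _; rewrite !linearZ gn.
Qed.

End Pmod.
End ProjectiveModules.

(** * Frames and projective modules *)

Section Frame.
Variables (k : fieldType) (L : falgType k).

(** The interface shared by both directions: an elementary algebra gets a frame by lifting
    idempotents, an algebra with a path basis from its trivial paths. *)
Record frame n (f : 'I_n -> L -> k) (e : 'I_n -> L) (J : {vspace L}) : Prop :=
  Frame {
    frame_lin : forall i (a : k) x y, f i (a *: x + y) = a * f i x + f i y;
    frameM : forall i x y, f i (x * y) = f i x * f i y;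
    frame_char : forall i j, f i (e j) = (i == j)%:R;
    frame_orth : forall i j, e i * e j = if i == j then e i else 0;
    frame_sum : \sum_i e i = 1;
    frame_radP : forall x, x \in J <-> forall i, f i x = 0;
    frame_nil : exists N, (J ^+ N)%VS = 0%VS }.

Lemma memv_mul_line (V : {vspace L}) (x y : L) :
  x \in (V * <[y]>)%VS -> exists2 v, v \in V & x = v * y.
Proof.
have sVy: (V * <[y]> <= amulr y @: V)%VS.
  apply/prodvP => u _ uV /vlineP[a ->]; rewrite -scalerAr memvZ //.
  by have := memv_img (amulr y) uV; rewrite lfunE /=.
by move=> /(subvP sVy)/memv_imgP[v vV ->]; exists v; rewrite // lfunE.
Qed.

Variables (n : nat) (f : 'I_n -> L -> k) (e : 'I_n -> L) (J : {vspace L}).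
Hypothesis frameF : frame f e J.
Let fM := frameM frameF.
Let eM := frame_orth frameF.
Let JP x := frame_radP frameF x.

Lemma frame0 i : f i 0 = 0.
Proof. by have := frame_lin frameF i (-1) 0 0; rewrite scaler0 add0r mulN1r addNr. Qed.

Lemma frameD i x y : f i (x + y) = f i x + f i y.
Proof. by have := frame_lin frameF i 1 x y; rewrite scale1r mul1r. Qed.

Lemma frameZ i a x : f i (a *: x) = a * f i x.
Proof. by have := frame_lin frameF i a x 0; rewrite !addr0 frame0 addr0. Qed.

Lemma frameB i x y : f i (x - y) = f i x - f i y.
Proof. by rewrite frameD -scaleN1r frameZ mulN1r. Qed.

Lemma frame1 i : f i 1 = 1.
Proof.
by have := fM i (e i) 1; rewrite mulr1 (frame_char frameF) eqxx mul1r => /esym.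
Qed.

Lemma frame_idem i : e i * e i = e i.
Proof. by rewrite eM eqxx. Qed.

Lemma frame_rad_mull x y : y \in J -> x * y \in J.
Proof. by rewrite !JP => yJ i; rewrite fM yJ mulr0. Qed.

Lemma frame_rad_mulr x y : x \in J -> x * y \in J.
Proof. by rewrite !JP => xJ i; rewrite fM xJ mul0r. Qed.

Lemma frame_mul_idem i v x : f i (x * e v) = if i == v then f v x else 0.
Proof.
rewrite fM (frame_char frameF).
by have [->|_] := eqVneq i v; rewrite ?mulr1 ?mulr0.
Qed.

Lemma frame_corner v x : x * e v - f v x *: e v \in J.
Proof.
rewrite JP => i; rewrite frameB frameZ frame_mul_idem (frame_char frameF).
by case: eqVneq => _; rewrite ?mulr1 ?mulr0 subrr.
Qed.

Lemma frame_rad_idem v x : (x * e v \in J) = (f v x == 0).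
Proof.
apply/idP/eqP => [|fx0].
  by rewrite JP => /(_ v); rewrite frame_mul_idem eqxx.
by have := frame_corner v x; rewrite fx0 scale0r subr0.
Qed.

(** The geometric series. *)
Lemma nil_left_inverse (j : L) N : j ^+ N = 0 -> exists u, u * (1 - j) = 1.
Proof.
move=> jN; exists (\sum_(i < N) j ^+ i).
have c : GRing.comm (1 - j) (\sum_(i < N) j ^+ i).
  apply: commr_sum => i _; apply/commrX/commr_sym.
  by apply: commrB => //; apply/commr1.
by rewrite -c -opprB mulNr -subrX1 jN sub0r opprK.
Qed.

Lemma frame_rad_nil j : j \in J -> exists N, j ^+ N = 0.
Proof.
move=> jJ; have [N JN] := frame_nil frameF; exists N; apply/eqP.
rewrite -memv0 -JN; elim: N {JN} => [|N IH]; first by rewrite expr0 memv_line.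
by rewrite exprS expvSl memv_mul.
Qed.

Lemma frame_unit j : j \in J -> exists u, u * (1 - j) = 1.
Proof. by move=> /frame_rad_nil[N]; apply: nil_left_inverse. Qed.

(** Locality of the corner at [e v]: the compression [y] of [x], scaled to have character [1], is
    congruent to [e v] modulo [J], so [1 - (e v - y)] has a left inverse; its product with [e v] is
    [y]. *)
Lemma frame_left_inverse v x : f v x != 0 -> exists u, u * x * e v = e v.
Proof.
move=> fx0; pose y := (f v x)^-1 *: (e v * x * e v).
have /frame_unit[u uj] : e v - y \in J.
  rewrite JP => i; rewrite frameB frameZ frame_mul_idem fM !(frame_char frameF).
  by rewrite eqxx mul1r; case: eqP => _; rewrite ?mulVf ?mulr0 ?subr0 ?subrr.
have yE : (1 - (e v - y)) * e v = y.
  rewrite mulrBl mul1r mulrBl frame_idem opprB addrC subrK /y.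
  by rewrite -scalerAl -[_ * e v * e v]mulrA frame_idem.
exists (u * ((f v x)^-1 *: e v)).
by rewrite -[RHS]mul1r -uj -[RHS]mulrA yE /y -!mulrA -!scalerAl mulrA.
Qed.

(** * Generators and relations of projective modules *)

Definition homogeneous_generators (P : lmodType L) m (v : 'I_m -> 'I_n)
    (x : 'I_m -> P) : Prop :=
  (forall i, e (v i) *: x i = x i) /\
  (forall p, exists c : 'I_m -> L, p = \sum_i c i *: x i).

(** As the [e j] sum to [1], the components of the given generators along the [e j] still
    generate. *)
Lemma fin_gen_homogeneous (P : lmodType L) :
  fin_gen P -> exists m v x, @homogeneous_generators P m v x.
Proof.
case=> s gen_s; pose I := ('I_(size s) * 'I_n)%type.
pose ev (i : 'I_#|{: I}|) : I := enum_val i.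
exists #|{: I}|, (fun i => (ev i).2), (fun i => e (ev i).2 *: s`_(ev i).1).
split=> [i|p]; first by rewrite scalerA frame_idem.
have [c ->] := gen_s p; exists (fun i => c (ev i).1).
pose F (i : I) := c i.1 *: (e i.2 *: s`_i.1).
rewrite -[RHS](reindex ev (P := xpredT) (F := F)) /=; last exact/onW_bij/enum_val_bij.
rewrite -(pair_bigA _ (fun i j => F (i, j))) /=.
apply: eq_bigr => i _; rewrite /F /= -scaler_sumr -scaler_suml.
by rewrite (frame_sum frameF) scale1r.
Qed.

(* A relation with a coefficient outside [J] lets one generator be discarded. *)
Lemma minimal_generators (P : lmodType L) m v (x : 'I_m -> P) :
  homogeneous_generators v x ->
  exists m' v' (x' : 'I_m' -> P), homogeneous_generators v' x' /\
    forall c : 'I_m' -> L, \sum_i c i *: x' i = 0 -> forall i, c i * e (v' i) \in J.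
Proof.
elim: m v x => [|m IHm] v x [hx gx].
  by exists 0%N, v, x; split=> // c _ [].
have [ok|bad] := pselect (forall c : 'I_m.+1 -> L, \sum_i c i *: x i = 0 ->
                           forall i, c i * e (v i) \in J).
  by exists m.+1, v, x.
have [c cx [i ci]] : exists2 c : 'I_m.+1 -> L, \sum_i c i *: x i = 0 &
    exists i, c i * e (v i) \notin J.
  apply: contrapT => H; apply: bad => c cx i; apply: contrapT => /negP ci.
  by apply: H; exists c => //; exists i.
rewrite frame_rad_idem in ci; have [u ue] := frame_left_inverse ci.
have xiE : x i = \sum_(j < m) (- (u * c (lift i j))) *: x (lift i j).
  rewrite -[LHS]hx -ue -!scalerA hx.
  move: cx; rewrite (bigD1_ord i) //= => /eqP; rewrite addr_eq0 => /eqP ->.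
  rewrite scalerN scaler_sumr -sumrN; apply: eq_bigr => j _.
  by rewrite scalerA scaleNr.
apply: (IHm (v \o lift i) (x \o lift i)); split=> [j|p]; first exact: hx.
have [d ->] := gx p; exists (fun j => d (lift i j) - d i * (u * c (lift i j))).
rewrite (bigD1_ord i) //= xiE scaler_sumr -big_split /=; apply: eq_bigr => j _.
by rewrite scalerA mulrN -scalerDl addrC.
Qed.

(* A section of the free cover is, in the generators [x], a matrix congruent to
   the identity modulo [J]; so a relation [c] satisfies [c = - c B] with [B]
   having entries in [J], whence its entries lie in every power of [J]. *)
Lemma projective_basis (P : lmodType L) : fin_gen P -> projective P ->
  exists m (v : 'I_m -> 'I_n) (x : 'I_m -> P), homogeneous_generators v x /\
    forall c : 'I_m -> L, \sum_i c i *: x i = 0 -> forall i, c i * e (v i) = 0.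
Proof.
move=> /fin_gen_homogeneous[m0 [v0 [x0 /minimal_generators]]].
move=> [m [v [x [[hx gx] relJ]]]] projP; exists m, v, x; split=> // c cx.
have [h hP] : exists h : {linear P -> {ffun 'I_m -> L^o}}, forall p, combo x (h p) = p.
  apply: (projP _ _ (combo x) idfun) => p; have [d ->] := gx p.
  by exists [ffun i => d i]; apply: eq_bigr => i _; rewrite ffunE.
pose B i j : L := (h (x i) j : L) * e (v j) - (i == j)%:R * e (v j).
(* Since [h] is a section, row [i] of [h] minus the [i]-th unit vector is a relation among the
   generators, to which [relJ] applies. *)
have BJ i j : B i j \in J.
  have := relJ (fun j => (h (x i) j : L) - (i == j)%:R) _ j.
  rewrite mulrBl; apply; rewrite (eq_bigr (fun l => (h (x i) l : L) *: x l
     - (i == l)%:R *: x l)); last by move=> l _; rewrite scalerBl.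
  rewrite sumrB (hP (x i) : \sum_l _ = _) (bigD1 i) //= eqxx scale1r big1 ?addr0 ?subrr //.
  by move=> l li; rewrite eq_sym (negPf li) scale0r.
have cB j : c j * e (v j) = - \sum_i (c i * e (v i)) * B i j.
  have /(congr1 (fun d : {ffun 'I_m -> L^o} => (d j : L) * e (v j))) :
    h (\sum_i c i *: x i) = 0 by rewrite cx linear0.
  rewrite linear_sum sum_ffunE ffunE mul0r mulr_suml => hE.
  have {}hE : \sum_i c i * e (v i) * (h (x i) j * e (v j)) = 0.
    rewrite -[RHS]hE; apply: eq_bigr => i _.
    rewrite -[in RHS](hx i) !linearZ /= !ffunE /= /(_ *: _) /=.
    by rewrite !mulrA.
  rewrite (eq_bigr (fun i => c i * e (v i) * (h (x i) j * e (v j)) -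
    c i * e (v i) * ((i == j)%:R * e (v j)))); last first.
    by move=> i _; rewrite mulrBr.
  rewrite sumrB hE sub0r opprK (bigD1 j) //= eqxx mul1r -mulrA frame_idem.
  rewrite big1 ?addr0 // => i /negPf ij.
  by rewrite ij mul0r mulr0.
have [N JN] := frame_nil frameF.
move=> i; apply/eqP; rewrite -memv0 -[0%VS](prodv0 fullv) -JN.
(* Each use of [cB] produces one more factor from [J] on the right. *)
elim: N i {JN} => [|N IHN] i; first by rewrite expv0 prodv1 memvf.
by rewrite cB memvN expvSr prodvA memv_suml // => l _; rewrite memv_mul.
Qed.

(** For generators as in [projective_basis], [P] is the direct sum of the submodule of the first
    generator and the span [B] of the others; the first generator being nonzero, [B] must vanish. *)
Lemma indecomposable_projective_cyclic (P : lmodType L) :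
  fin_gen P -> projective P -> indecomposable P ->
  exists v (x0 : P), [/\ e v *: x0 = x0, x0 != 0,
    forall p, exists c : L, p = c *: x0 &
    forall c : L, c *: x0 = 0 -> c * e v = 0].
Proof.
move=> fgP projP [[p0 p0_neq0] indP].
have [[|m] [v [x [[hx gx] rx]]]] := projective_basis fgP projP.
  by have [c p0E] := gx p0; rewrite p0E big_ord0 eqxx in p0_neq0.
pose A p := exists c : L, p = c *: x ord0.
pose B p := exists c : 'I_m -> L, p = \sum_j c j *: x (lift ord0 j).
have rel c (d : 'I_m -> L) : c *: x ord0 = \sum_j d j *: x (lift ord0 j) ->
    c * e (v ord0) = 0.
  move=> cd; pose h i := if unlift ord0 i is Some j then - d j else c.
  have := rx h _ ord0; rewrite /h unlift_none; apply.
  rewrite big_ord_recl unlift_none cd -big_split big1 // => j _ /=.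
  by rewrite liftK scaleNr subrr.
have free0 c : c *: x ord0 = 0 -> c * e (v ord0) = 0.
  move=> cx; apply: (rel c (fun=> 0)); rewrite cx big1 // => j _.
  by rewrite scale0r.
have x_neq0 : x ord0 != 0.
  apply/eqP => x0; have := congr1 (f (v ord0)) (free0 1 _).
  rewrite x0 scaler0 mul1r (frame_char frameF) eqxx frame0 => /(_ erefl)/eqP.
  by rewrite oner_eq0.
have [||||A0|B0] := indP A B.
- split; first by exists 0; rewrite scale0r.
  split=> [_ _ [c ->] [d ->]|a _ [c ->]]; first by exists (c + d); rewrite scalerDl.
  by exists (a * c); rewrite scalerA.
- split; first by exists (fun=> 0); rewrite big1 // => j _; rewrite scale0r.
  split=> [_ _ [c ->] [d ->]|a _ [c ->]].
    exists (fun j => c j + d j); rewrite -big_split; apply: eq_bigr => j _ /=.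
    by rewrite scalerDl.
  by exists (fun j => a * c j); rewrite scaler_sumr; apply: eq_bigr => j _; rewrite scalerA.
- move=> p [c ->] [d cd]; rewrite -(hx ord0) scalerA.
  by rewrite (rel _ _ cd) scale0r.
- move=> p; have [c ->] := gx p; rewrite big_ord_recl.
  exists (c ord0 *: x ord0), (\sum_j c (lift ord0 j) *: x (lift ord0 j)).
  by split; [exists (c ord0) | split=> //; exists (fun j => c (lift ord0 j))].
- by case/eqP: x_neq0; apply: A0; exists 1; rewrite scale1r.
exists (v ord0), (x ord0); split=> // p; have [c ->] := gx p; exists (c ord0).
rewrite big_ord_recl [X in _ + X]B0 ?addr0 //.
by exists (fun j => c (lift ord0 j)).
Qed.

(** * Cyclic modules generated by a homogeneous vector, and their radicals *)

Section CyclicModule.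
Variables (P : lmodType L) (x0 : P) (v : 'I_n).
Hypothesis ex0 : e v *: x0 = x0.
Hypothesis x0_neq0 : x0 != 0.
Hypothesis gen_x0 : forall p, exists c : L, p = c *: x0.

Lemma cyclic_fin_gen : fin_gen P.
Proof.
exists [:: x0] => p; have [c ->] := gen_x0 p; exists (fun _ => c).
by rewrite big_ord1.
Qed.

(** By [frame_left_inverse] some multiple of [c *: x0] is the generator [x0]. *)
Lemma cyclic_submod_full (S : P -> Prop) (c : L) :
  submod S -> S (c *: x0) -> f v c != 0 -> forall p, S p.
Proof.
move=> [_ [_ SZ]] Sc /frame_left_inverse[u ue] p.
have [d ->] := gen_x0 p; apply: (SZ).
by rewrite -ex0 -ue -!scalerA ex0; apply: SZ.
Qed.

Lemma cyclic_coef c : c *: x0 = 0 -> f v c = 0.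
Proof.
move=> cx; apply/eqP; apply: contraNT x0_neq0 => /frame_left_inverse[u ue].
by rewrite -ex0 -ue -!scalerA ex0 cx scaler0.
Qed.

(** Split [x0] as [a + b]. The characters of the two coefficients add up to [1], so one of them is
    nonzero and the corresponding summand is everything. *)
Lemma cyclic_indecomposable : indecomposable P.
Proof.
split; first by exists x0.
move=> A B subA subB AB0 ABT; have [a [b [Aa [Bb x0E]]]] := ABT x0.
have [[ca aE] [cb bE]] := (gen_x0 a, gen_x0 b).
have [fa0|fa] := eqVneq (f v ca) 0; last first.
  right=> x Bx; apply: AB0 => //; apply: (cyclic_submod_full (c := ca)) => //.
  by rewrite -aE.
left=> x Ax; apply: AB0 => //; apply: (cyclic_submod_full (c := cb)) => //.
  by rewrite -bE.
have /cyclic_coef : (1 - ca - cb) *: x0 = 0.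
  by rewrite !scalerBl scale1r -aE -bE {1}x0E [a + b]addrC addrK subrr.
rewrite !frameB frame1 fa0 subr0 => /eqP.
by rewrite subr_eq0 => /eqP <-; rewrite oner_neq0.
Qed.

(** The submodule [J x0] is proper and contains every proper submodule, so it is the unique maximal
    one. *)
Lemma cyclic_rad p : Defs.rad p <-> exists2 c, c \in J & p = c *: x0.
Proof.
pose S0 p := exists2 c, c \in J & p = c *: x0.
have sub0 : submod S0.
  split; first by exists 0; rewrite ?mem0v ?scale0r.
  split=> [_ _ [c cJ ->] [d dJ ->]|b _ [c cJ ->]].
    by exists (c + d); rewrite ?memvD ?scalerDl.
  by exists (b * c); rewrite ?frame_rad_mull ?scalerA.
have S0P c : f v c = 0 -> S0 (c *: x0).
  move=> fc; exists (c * e v); first by rewrite frame_rad_idem fc.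
  by rewrite -scalerA ex0.
have nS0 : ~ S0 x0.
  case=> c cJ cx; have /cyclic_coef : (1 - c) *: x0 = 0.
    by rewrite scalerBl scale1r -cx subrr.
  by rewrite frameB frame1 (JP c).1 // subr0 => /eqP; rewrite oner_eq0.
split=> [radp|S0p S [subS [[y nSy] maxS]]].
  apply: (radp S0); split=> //; split; first by exists x0.
  move=> T subT S0T; have [TS0|nTS0] := pselect (forall x, T x -> S0 x).
    by right.
  left; apply: contrapT => nT; apply: nTS0 => x Tx.
  have [c xE] := gen_x0 x; rewrite xE; apply: S0P.
  apply/eqP; apply: contrapT => /negP fc; apply: nT.
  by apply: (cyclic_submod_full (c := c)) => //; rewrite -xE.
have SS0 x : S x -> S0 x.
  have [c ->] := gen_x0 x => Sc; apply: S0P; apply/eqP; apply: contrapT => /negP fc.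
  by apply: nSy; apply: (cyclic_submod_full (c := c)).
by have [S0T|] := maxS _ sub0 SS0; [case: nS0 | apply].
Qed.

End CyclicModule.

(* [L e_v] as a left module: [pmod] indexed by a singleton *)
Definition vertex_mod v := pmod (fun _ : unit => e v).
Definition vertex_gen v : vertex_mod v := pmod_gen (fun=> frame_idem v) tt.

Lemma vertex_genE v (p : vertex_mod v) : p = (val p tt : L) *: vertex_gen v.
Proof. by rewrite {1}(pmod_genE (fun=> frame_idem v) p) (big_pred1 tt) //; case. Qed.

Lemma vertex_gen_val v (c : L) : val (c *: vertex_gen v) tt = c * e v :> L.
Proof. by rewrite /= !ffunE. Qed.

Lemma vertex_gen_idem v : e v *: vertex_gen v = vertex_gen v.
Proof.
by rewrite [LHS]vertex_genE vertex_gen_val frame_idem [RHS]vertex_genE /= ffunE.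
Qed.

Lemma vertex_gen_neq0 v : vertex_gen v != 0.
Proof.
apply/eqP => /(congr1 (fun p : vertex_mod v => f v (val p tt : L))) /=.
rewrite !ffunE frame0 (frame_char frameF) eqxx.
by move/eqP; rewrite oner_eq0.
Qed.

Let vertex_genP v p : exists c : L, p = c *: vertex_gen v.
Proof. by exists (val p tt); apply: vertex_genE. Qed.

Lemma vertex_rad v p : Defs.rad p <-> exists2 c, c \in J & p = c *: vertex_gen v.
Proof.
exact: cyclic_rad (vertex_gen_idem v) (vertex_gen_neq0 v) (@vertex_genP v) p.
Qed.

Lemma vertex_condF v : condF L ->
  proj_sub (@Defs.rad _ (vertex_mod v)) \/ simple_sub (@Defs.rad _ (vertex_mod v)).
Proof.
apply; first exact: cyclic_fin_gen (@vertex_genP v).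
  exact: pmod_projective (fun=> frame_idem v).
exact: cyclic_indecomposable (vertex_gen_idem v) (vertex_gen_neq0 v) (@vertex_genP v).
Qed.

(* [J e_v] is the direct sum of the [L a_i], with [L a_i] isomorphic to [L e_(t i)] *)
Definition rad_basis v m (t : 'I_m -> 'I_n) (a : 'I_m -> L) : Prop :=
  [/\ forall i, [/\ a i \in J, e (t i) * a i = a i & a i * e v = a i],
      forall y, y \in J -> exists c : 'I_m -> L, y * e v = \sum_i c i * a i &
      forall c : 'I_m -> L, \sum_i c i * a i = 0 -> forall i, c i * e (t i) = 0].

(** The map [g] identifies [Q] with the left ideal [J e_v], so a basis of the projective module [Q]
    can be carried over. *)
Lemma proj_sub_rad_basis v :
  proj_sub (@Defs.rad _ (vertex_mod v)) -> exists m t a, @rad_basis v m t a.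
Proof.
case=> Q [j [jinj [projQ imj]]].
pose V := (J * <[e v]>)%VS; pose g (q : Q) : L := val (j q) tt.
have gD x y : g (x + y) = g x + g y by rewrite /g raddfD /= ffunE.
have gZ (c : L) x : g (c *: x) = c * g x by rewrite /g linearZ /= ffunE.
have g0 : g 0 = 0 by rewrite -(scale0r 0) gZ mul0r.
have gS I (r : seq I) F : g (\sum_(i <- r) F i) = \sum_(i <- r) g (F i).
  by apply: (big_morph g gD g0).
have ginj : injective g.
  move=> x y gxy; apply: jinj; rewrite (vertex_genE (j x)) (vertex_genE (j y)).
  by congr (_ *: _).
have gV q : g q \in V.
  have /vertex_rad[c cJ jq] : Defs.rad (j q) by apply/imj; exists q.
  by rewrite /g jq vertex_gen_val memv_mul ?memv_line.
have imV y : y \in V -> exists q, y = g q.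
  move=> /memv_mul_line[c cJ ->].
  have [|q jq] := (imj (c *: vertex_gen v)).1; first by apply/vertex_rad; exists c.
  by exists q; rewrite /g -jq vertex_gen_val.
(* Preimages of a [k]-basis of [V] generate [Q]. *)
have fgQ : fin_gen Q.
  have /choice[s sP] : forall i : 'I_(\dim V), exists q, (vbasis V)`_i = g q.
    by move=> i; apply/imV/vbasis_mem/mem_nth; rewrite size_tuple.
  exists [seq s i | i <- enum 'I_(\dim V)] => q.
  have szs : size [seq s i | i <- enum 'I_(\dim V)] = \dim V.
    by rewrite size_map size_enum_ord.
  exists (fun i => (coord (vbasis V) (cast_ord szs i) (g q))%:A); apply: ginj.
  rewrite gS {1}(coord_vbasis (gV q)) (reindex (cast_ord szs)) /=; last first.
    by apply: onW_bij; exists (cast_ord (esym szs)) => i; apply: val_inj.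
  apply: eq_bigr => i _; rewrite gZ mulr_algl (sP (cast_ord szs i) : (vbasis V)`_i = _).
  congr (_ *: g _).
  rewrite (nth_map (cast_ord szs i)) ?(nth_ord_enum _ (cast_ord szs i)) //.
  by rewrite size_enum_ord -[ltnRHS]szs.
have [m [t [x [[hx gx] rx]]]] := projective_basis fgQ projQ.
exists m, t, (g \o x); split=> [i|y yJ|c cg].
- split=> /=; last 1 first.
  + by have /memv_mul_line[c cJ ->] := gV (x i); rewrite -mulrA frame_idem.
  + by have /memv_mul_line[c cJ ->] := gV (x i); rewrite frame_rad_mulr.
  + by rewrite -gZ hx.
- have [|q ->] := imV (y * e v); first by rewrite memv_mul ?memv_line.
  have [c qE] := gx q; exists c; rewrite {1}qE gS.
  by apply: eq_bigr => i _; rewrite gZ.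
apply: rx; apply: ginj; rewrite gS g0 -[RHS]cg.
by apply: eq_bigr => i _; rewrite gZ.
Qed.

(** A nonzero element of [J e_v] has a nonzero component [a] at some vertex [w]. Simplicity makes
    [L a] all of [J e_v] and forces [J a = 0], so [L a] is the line [k a]. *)
Lemma simple_sub_rad_line v : simple_sub (@Defs.rad _ (vertex_mod v)) ->
  exists w a, [/\ a \in J, a != 0, e w * a = a, a * e v = a &
    (forall y, y \in J -> y * a = 0) /\
    forall y, y \in J -> exists l : k, y * e v = l *: a].
Proof.
case=> [_ [[p [/vertex_rad[c cJ ->] cg]] minS]].
have ce0 : c * e v != 0.
  by apply: contraNneq cg => ce; rewrite [_ *: _]vertex_genE vertex_gen_val ce scale0r.
have [w ew] : exists w, e w * (c * e v) != 0.
  apply: contrapT => H; case/eqP: ce0; rewrite -[LHS]mul1r -(frame_sum frameF).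
  rewrite mulr_suml big1 // => w _; apply/eqP; apply: contrapT => /negP ew.
  by apply: H; exists w.
pose a := e w * (c * e v); pose y0 := e w * c *: vertex_gen v.
have aE : val y0 tt = a :> L by rewrite vertex_gen_val -mulrA.
have aJ : a \in J by rewrite frame_rad_mull ?frame_rad_mulr.
have rad_y0 d : Defs.rad (d *: y0).
  apply/vertex_rad; exists (d * (e w * c)); first by do 2!apply: frame_rad_mull.
  by rewrite scalerA.
have y0_neq0 : y0 != 0.
  by apply: contraNneq ew => y00; rewrite -/a -aE y00 /= ffunE.
have subs (K : {vspace L}) : (forall u y, y \in K -> u * y \in K) ->
    submod (fun p => exists2 d, d \in K & p = d *: y0).
  move=> idK; split; first by exists 0; rewrite ?mem0v ?scale0r.
  split=> [_ _ [d1 d1K ->] [d2 d2K ->]|u _ [d dK ->]].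
    by exists (d1 + d2); rewrite ?memvD ?scalerDl.
  by exists (u * d); rewrite ?idK ?scalerA.
(* By simplicity [J y0] is zero or contains [y0]; in the latter case [y0 = d *: y0] with [d] in [J],
   and the left inverse of [1 - d] gives [y0 = 0]. *)
have Ja y : y \in J -> y * a = 0.
  have [|H yJ|H] := minS _ (subs J frame_rad_mull).
  - by move=> _ [d _ ->]; apply: rad_y0.
  - have := H (y *: y0) (ex_intro2 _ _ y yJ erefl).
    move/(congr1 (fun p : vertex_mod v => val p tt : L)).
    by rewrite [y *: y0]scalerA vertex_gen_val -!mulrA /= ffunE.
  have [|d dJ y0E] := H y0; first by rewrite -[y0]scale1r; apply: rad_y0.
  have [u ud] := frame_unit dJ; case/eqP: y0_neq0.
  by rewrite -[y0]scale1r -ud -scalerA scalerBl scale1r -y0E subrr scaler0.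
have ewa : e w * a = a by rewrite /a mulrA frame_idem.
exists w, a; split=> //; first by rewrite /a -!mulrA frame_idem.
split=> // y yJ.
have [|H|H] := minS _ (subs fullv (fun _ _ _ => memvf _)).
- by move=> _ [d _ ->]; apply: rad_y0.
- by case/eqP: y0_neq0; apply: H; exists 1; rewrite ?memvf ?scale1r.
have [|d _ yE] := H (y *: vertex_gen v); first by apply/vertex_rad; exists y.
exists (f w d); move/(congr1 (fun p : vertex_mod v => val p tt : L)): yE.
rewrite vertex_gen_val => ->; rewrite [d *: y0]scalerA vertex_gen_val -!mulrA -/a.
rewrite -{1}ewa mulrA -[d * e w](subrK (f w d *: e w)) mulrDl.
by rewrite Ja ?frame_corner // add0r -scalerAl ewa.
Qed.

(** If [J e_w = 0], then [L e_w] is the line [k e_w], so the line [k a] is a copy of it, hence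
    projective. This will show that a vertex [rho d] outside [D] is the source of an arrow. *)
Lemma rad_basis_simple v w (a : L) :
  [/\ a \in J, a != 0, e w * a = a & a * e v = a] ->
  (forall y, y \in J -> exists l : k, y * e v = l *: a) ->
  (forall y, y \in J -> y * e w = 0) ->
  exists m t b, @rad_basis v m t b.
Proof.
move=> [aJ a0 ewa aev] lineJ Jw; exists 1%N, (fun=> w), (fun=> a); split=> //.
  by move=> y /lineJ[l ->]; exists (fun=> l%:A); rewrite big_ord1 mulr_algl.
move=> c; rewrite big_ord1 => ca i; rewrite (ord1 i).
have cE : c ord0 * e w = f w (c ord0) *: e w.
  apply/eqP; rewrite -subr_eq0; apply/eqP.
  have := Jw _ (frame_corner w (c ord0)).
  by rewrite mulrBl -scalerAl -mulrA frame_idem.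
move: ca; rewrite -ewa mulrA cE -scalerAl ewa => /eqP.
by rewrite scaler_eq0 (negPf a0) orbF => /eqP ->; rewrite scale0r.
Qed.

End Frame.

(** * The radical of an elementary algebra *)

Section Radical.
Variables (k : fieldType) (L : falgType k).

(** Induction on the codimension of [U]: finite dimension takes the place of Zorn's lemma. *)
Lemma max_left_ideal (U : {vspace L}) : (fullv * U <= U)%VS -> 1 \notin U ->
  exists M : {vspace L}, [/\ (U <= M)%VS, (fullv * M <= M)%VS, 1 \notin M &
    forall V : {vspace L}, (fullv * V <= V)%VS -> (M <= V)%VS -> 1 \notin V -> V = M].
Proof.
have [d] := ubnP (\dim {:L} - \dim U); elim: d U => // d IHd U dU idU U1.
have [[V [idV UV V1 VU]]|maxU] := pselect (exists V : {vspace L},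
    [/\ (fullv * V <= V)%VS, (U <= V)%VS, 1 \notin V & V <> U]); last first.
  exists U; split=> // V idV UV V1; apply: contrapT => VU.
  by apply: maxU; exists V.
have dUV : (\dim U < \dim V)%N.
  rewrite ltn_neqAle dimvS // andbT; apply/eqP => dUV.
  by apply: VU; apply/esym/eqP; rewrite eqEdim UV dUV /=.
have [|M [VM ? ? ?]] := IHd V _ idV V1.
  rewrite (leq_trans _ (_ : \dim {:L} - \dim U <= d)%N) // ltn_sub2l //.
  by rewrite (leq_trans dUV) // dimvS // subvf.
by exists M; split=> //; apply: subv_trans VM.
Qed.

(** Otherwise the left ideal generated by [1 - j] is proper and lies in a maximal one, which also
    contains [j], hence [1]. *)
Lemma jrad_left_inverse (j : L) : jrad j -> exists u, u * (1 - j) = 1.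
Proof.
move=> radj; apply: contrapT => nu; pose U : {vspace L} := (fullv * <[1 - j]>)%VS.
have [||M [UM idM M1 maxM]] := @max_left_ideal U.
- by rewrite prodvA prodvSl ?subvf.
- by apply/negP => /memv_mul_line[u _ uj]; apply: nu; exists u.
have mulM c x : x \in M -> c * x \in M.
  by move=> xM; apply: (subvP idM); rewrite memv_mul ?memvf.
suff maxM' : maxsub (fun x : L^o => (x : L) \in M).
  have jM : j \in M by apply: (radj _ maxM').
  have : 1 - j \in M.
    by apply: (subvP UM); rewrite -[1 - j]mul1r memv_mul ?memvf ?memv_line.
  by rewrite rpredBr // (negPf M1).
split; first split; first by rewrite mem0v.
  by split=> [x y xM yM|c x xM]; [rewrite memvD | apply: mulM].
split; first by exists 1; apply/negP.
move=> T [T0 [TD TZ]] MT.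
have [TM|nTM] := pselect (forall x, T x -> x \in M); first by right.
left=> x; apply: contrapT => nTx; apply: nTM => y Ty.
(* The ideal [M] is maximal among subspaces, while [T] is any predicate. The subspace [V] bridges
   the gap: if it contains [1], then [T] is everything; otherwise [V = M] and [y] is in [M]. *)
pose V : {vspace L} := (M + fullv * <[y : L]>)%VS.
have yV : (y : L) \in V.
  apply: (subvP (addvSr _ _)); rewrite -[X in X \in _]mul1r.
  by rewrite memv_mul ?memvf ?memv_line.
suff VM : V = M by rewrite -VM.
apply: maxM; rewrite ?addvSl //.
  rewrite prodvDr prodvA addvS ?prodvSl ?subvf //.
apply/negP => /memv_addP[m mM [_ /memv_mul_line[c _ ->] E]]; apply: nTx.
rewrite -[x]mulr1 E mulrDr; apply: TD; first exact/MT/mulM.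
by rewrite mulrA; apply: TZ.
Qed.

(** * Nakayama's lemma and nilpotence *)

Section Nilpotence.
Variable J : {vspace L}.
Hypothesis idealJl : (fullv * J <= J)%VS.
Hypothesis idealJr : (J * fullv <= J)%VS.
Hypothesis quasi_regular : forall j, j \in J -> exists u, u * (1 - j) = 1.

(** The first generator satisfies [x = j * x + y] with [j] in [J] and [y] coming from the other
    generators; inverting [1 - j] makes [x] redundant. *)
Lemma left_ideal_nakayama (X : seq L) :
  (fullv * <<X>> <= J * (fullv * <<X>>))%VS -> (fullv * <<X>>)%VS = 0%VS.
Proof.
elim: X => [|x X IHX]; first by rewrite span_nil prodv0.
move=> sub; suff xX : x \in (fullv * <<X>>)%VS.
  suff E : (fullv * <<x :: X>> = fullv * <<X>>)%VS by rewrite E in sub *; apply: IHX.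
  apply: subv_anti; apply/andP; split; last first.
    by rewrite prodvSr // span_cons addvSr.
  rewrite span_cons prodvDr subv_add subvv andbT.
  have /(prodvSr fullv) : (<[x]> <= fullv * <<X>>)%VS by rewrite -memvE.
  by move/subv_trans; apply; rewrite prodvA prodvSl ?subvf.
have : x \in (fullv * <<x :: X>>)%VS.
  by rewrite -[X in X \in _]mul1r memv_mul ?memvf // memv_span ?mem_head.
move=> /(subvP sub); rewrite prodvA => /(subvP (prodvSl _ idealJr)).
rewrite span_cons prodvDr => /memv_addP[_ /memv_mul_line[j jJ ->] [y yX xE]].
have [u uj] := quasi_regular jJ.
have -> : x = u * y.
  by rewrite -[LHS]mul1r -uj -mulrA mulrBl mul1r {1}xE addrAC subrr add0r.
apply: (subvP (_ : fullv * (J * <<X>>) <= _)%VS); last by rewrite memv_mul ?memvf.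
by rewrite prodvA prodvSl ?subvf.
Qed.

(** The powers of [J] decrease, so for dimension reasons two consecutive ones agree, and this stable
    power vanishes by Nakayama's lemma. *)
Lemma quasi_regular_nilpotent : exists N, (J ^+ N)%VS = 0%VS.
Proof.
have dec m : (J ^+ m.+2 <= J ^+ m.+1)%VS.
  elim: m => [|m IH]; first by rewrite (subv_trans _ idealJl) // prodvSl ?subvf.
  by rewrite expvSl [X in (_ <= X)%VS]expvSl prodvSr.
have [m E] : exists m, (J ^+ m.+2 = J ^+ m.+1)%VS.
  apply: contrapT => H.
  have dimJ m : (\dim (J ^+ m.+1) + m <= \dim {:L})%N.
    elim: m => [|m IH]; first by rewrite addn0 dimvS ?subvf.
    apply: leq_trans IH; rewrite addnS -addSn leq_add2r ltn_neqAle dimvS // andbT.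
    apply/eqP => E; apply: H; exists m; apply/eqP.
    by rewrite eqEdim dec E /=.
  by have := leq_trans (leq_addl _ _) (dimJ (\dim {:L}).+1); rewrite ltnn.
exists m.+1; have fJ : (fullv * J ^+ m.+1 = J ^+ m.+1)%VS.
  apply: subv_anti; rewrite {1}expvSl prodvA [X in (_ <= X)%VS && _]expvSl prodvSl //=.
  by apply/subvP => x xJ; rewrite -[x]mul1r memv_mul ?memvf.
rewrite -fJ -[X in (_ * X)%VS](span_basis (vbasisP _)).
apply: left_ideal_nakayama; rewrite (span_basis (vbasisP _)) fJ -expvSl.
by rewrite E.
Qed.

End Nilpotence.

(** A computation with polynomials, evaluated at [y]: [1 - (1 - A)^(N+1)] is divisible by
    [A = X^(N+1)], and [1 - A] by [1 - X], so [z * (1 - z)] contains the factor that vanishes. The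
    factorizations of [z] through [y] will keep lifted idempotents orthogonal. *)
Lemma lift_idempotent (y : L) N : (y * (1 - y)) ^+ N.+1 = 0 ->
  let z := 1 - (1 - y ^+ N.+1) ^+ N.+1 in
  z * z = z /\ exists w, z = y * w /\ z = w * y.
Proof.
move=> yN z; pose phi := horner_alg y : {rmorphism {poly k} -> L}.
pose A : {poly k} := 'X ^+ N.+1.
pose S : {poly k} := \sum_(i < N.+1) (1 - A) ^+ i.
pose S' : {poly k} := \sum_(i < N.+1) 'X ^+ i.
have phiX : phi 'X = y by exact: horner_algX.
have ZE : 1 - (1 - A) ^+ N.+1 = A * S.
  by rewrite -[LHS]opprB subrX1 -mulNr opprB subKr.
have CE : 1 - A = (1 - 'X) * S'.
  by rewrite -[LHS]opprB subrX1 -mulNr opprB.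
have zE : z = phi (1 - (1 - A) ^+ N.+1).
  by rewrite rmorphB rmorphXn rmorphB rmorph1 rmorphXn /= phiX.
split; last first.
  exists (phi ('X ^+ N * S)); rewrite zE ZE /A exprS -mulrA -phiX.
  by split; [rewrite rmorphM | rewrite mulrC rmorphM].
apply/eqP; rewrite -subr_eq0 -opprB oppr_eq0 -{1}[z]mulr1 -mulrBr.
have -> : 1 - z = phi ((1 - A) ^+ N.+1).
  by rewrite opprB addrC subrK rmorphXn rmorphB rmorph1 rmorphXn /= phiX.
rewrite zE ZE CE exprMn -rmorphM mulrAC !mulrA.
have -> : A * (1 - 'X) ^+ N.+1 * S'^+ N.+1 * S = ('X * (1 - 'X)) ^+ N.+1 * (S' ^+ N.+1 * S).
  by rewrite exprMn -!mulrA.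
by rewrite rmorphM rmorphXn rmorphM rmorphB rmorph1 /= phiX yN mul0r.
Qed.

(** The common kernel [J] of the characters is quasi-regular, hence nilpotent, and the idempotents
    of [k^n] are lifted one at a time. *)
Lemma elementary_frame : elementary L -> exists n f e J, @frame _ L n f e J.
Proof.
case=> n [f [flin [fM [f1 [fsurj fjrad]]]]].
have glin : linear (fun x => \row_i f i x : 'rV[k]_n).
  by move=> a x y; apply/rowP => i; rewrite !mxE flin.
pose g : {linear L -> 'rV[k]_n} := HB.pack (fun x => \row_i f i x : 'rV[k]_n)
  (GRing.isLinear.Build k L 'rV[k]_n _ _ glin).
pose J := lker (linfun g).
have JP x : x \in J <-> forall i, f i x = 0.
  rewrite memv_ker lfunE /=; split=> [/eqP/rowP gx i|fx].
    by have := gx i; rewrite !mxE.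
  by apply/eqP/rowP => i; rewrite !mxE.
have Jl : (fullv * J <= J)%VS.
  by apply/prodvP => x y _; rewrite !JP => fy i; rewrite fM fy mulr0.
have Jr : (J * fullv <= J)%VS.
  by apply/prodvP => x y; rewrite !JP => fx _ i; rewrite fM fx mul0r.
have Jq j : j \in J -> exists u, u * (1 - j) = 1.
  by rewrite JP => /fjrad; apply: jrad_left_inverse.
have [N0 JN0] := quasi_regular_nilpotent Jl Jr Jq.
have nil (j : L) : j \in J -> j ^+ N0.+1 = 0.
  move=> jJ; apply/eqP; rewrite exprS -memv0 -[0%VS](prodv0 fullv) -JN0.
  rewrite memv_mul ?memvf //; elim: N0 {JN0} => [|N IH]; first by rewrite expr0 memv_line.
  by rewrite exprS expvSl memv_mul.
have f0 i : f i 0 = 0 by have := flin i (-1) 0 0; rewrite scaler0 add0r mulN1r addNr.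
have fD i x y : f i (x + y) = f i x + f i y.
  by have := flin i 1 x y; rewrite scale1r mul1r.
have fB i x y : f i (x - y) = f i x - f i y.
  by rewrite addrC -scaleN1r flin mulN1r addrC.
have fX i x m : f i (x ^+ m) = f i x ^+ m.
  by elim: m => [|m IH]; rewrite ?expr0 // !exprS fM IH.
have fS i (I : finType) (P : pred I) F : f i (\sum_(j | P j) F j) = \sum_(j | P j) f i (F j).
  exact: (big_morph (f i) (fD i) (f0 i)).
(* The lifting polynomial fixes [0] and [1], so lifting preserves the values of the characters. *)
have idem (b : bool) m : 1 - (1 - b%:R ^+ m.+1) ^+ m.+1 = b%:R :> k.
  by case: b; rewrite ?expr1n ?expr0n /= ?subrr ?subr0 ?expr0n ?expr1n ?subr0 ?subrr.
have lift_e r : (r <= n)%N -> exists e : 'I_n -> L,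
    (forall i j : 'I_n, (j < r)%N -> f i (e j) = (i == j)%:R) /\
    forall i j : 'I_n, (i < r)%N -> (j < r)%N -> e i * e j = if i == j then e i else 0.
  elim: r => [|r IHr] rn; first by exists (fun=> 0); split.
  have [e [ef eM]] := IHr (ltnW rn).
  pose g0 := 1 - \sum_(i < n | (i < r)%N) e i.
  have eg (i : 'I_n) : (i < r)%N -> e i * g0 = 0.
    move=> ir; rewrite mulrBr mulr1 mulr_sumr (bigD1 i) //= eM // eqxx.
    by rewrite big1 ?addr0 ?subrr // => j /andP[jr /negPf ji]; rewrite eM // eq_sym ji.
  have ge (i : 'I_n) : (i < r)%N -> g0 * e i = 0.
    move=> ir; rewrite mulrBl mul1r mulr_suml (bigD1 i) //= eM // eqxx.
    by rewrite big1 ?addr0 ?subrr // => j /andP[jr /negPf ji]; rewrite eM // ji.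
  pose ri := Ordinal rn.
  have [x fx] := fsurj (fun i => (i == ri)%:R).
  (* Compression by the complement [g0] makes [y] orthogonal to the idempotents already found; [z],
     a left and right multiple of [y], inherits this. *)
  pose y := g0 * x * g0.
  have fy i : f i y = (i == ri)%:R.
    rewrite !fM fx fB f1 fS; have [->|_] := eqVneq i ri; last by rewrite mulr0 mul0r.
    rewrite big1 ?subr0 ?mulr1 // => j jr; rewrite ef // -val_eqE /=.
    by case: eqP jr => // <-; rewrite ltnn.
  have /nil yN : y * (1 - y) \in J.
    rewrite JP => i; rewrite fM fB f1 fy.
    by case: eqP => _; rewrite ?subrr ?mulr0 ?mul0r.
  have [zz [w [zyw zwy]]] := lift_idempotent yN.
  set z := 1 - _ in zz zyw zwy.
  have fz i : f i z = (i == ri)%:R by rewrite fB fX fB fX f1 fy idem.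
  have ez (i : 'I_n) : (i < r)%N -> e i * z = 0.
    by move=> ir; rewrite zyw /y !mulrA eg // !mul0r.
  have ze (i : 'I_n) : (i < r)%N -> z * e i = 0.
    by move=> ir; rewrite zwy /y -!mulrA ge // !mulr0.
  have lt_r (i : 'I_n) : (i < r.+1)%N -> i != ri -> (i < r)%N.
    by rewrite ltnS leq_eqVlt -val_eqE => /orP[->|].
  exists (fun i => if i == ri then z else e i); split=> [i j jr|i j ir jr].
    by have [->|/(lt_r _ jr) ?] := eqVneq j ri; [rewrite fz | rewrite ef].
  case: (boolP (i == ri)) (boolP (j == ri)) => [/eqP-> | i_ri] [/eqP-> | j_ri].
  - by rewrite eqxx.
  - by rewrite eq_sym (negPf j_ri) ze // lt_r.
  - by rewrite (negPf i_ri) ez // lt_r.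
  by rewrite eM // lt_r.
have [e [ef eM]] := lift_e n (leqnn n).
exists n, f, e, J; split=> // [i j|i j||]; [exact: ef | exact: eM | | by exists N0].
(* The defect [g0] is an idempotent lying in [J], hence nilpotent, hence zero. *)
apply/eqP; rewrite eq_sym -subr_eq0; set g0 := 1 - _.
have gg : g0 * g0 = g0.
  rewrite {2}/g0 mulrBr mulr1 mulr_sumr big1 ?subr0 // => j _.
  rewrite mulrBl mul1r mulr_suml (bigD1 j) //= eM // eqxx.
  by rewrite big1 ?addr0 ?subrr // => i /negPf ij; rewrite eM // ij.
have gX m : g0 ^+ m.+1 = g0 by elim: m => // m IH; rewrite exprS IH.
rewrite -(gX N0) nil // JP => i; rewrite fB f1 fS (bigD1 i) //= ef // eqxx.
by rewrite big1 ?addr0 ?subrr // => j /negPf ji; rewrite ef // eq_sym ji.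
Qed.

End Radical.

(** * The path basis *)

Section AllowedPaths.
Variable T : triple.
Local Notation G := (tG T).
Implicit Types (p q : hpath T) (x : harrow T) (s : seq (harrow T)).

Definition old_arrow x : bool := if x is inl _ then true else false.

Lemma allowed_nil v : allowed (v, [::] : seq (harrow T)).
Proof. by []. Qed.

(** The recursive form behind all inductions on paths: a new arrow can only come last. *)
Lemma allowed_cons v x s : allowed (v, x :: s) =
  [&& hvalid x, hsrc x == v, allowed (htgt x, s) & (s == [::]) || old_arrow x].
Proof.
case: s => [|y s]; rewrite /allowed /hpath_ok /= ?andbT //.
rewrite [hsrc y == _]eq_sym -/(old_arrow x).
case: (hvalid x) (hsrc x == v) (old_arrow x) (hvalid y) => [] [] [] [] //=;
  by rewrite ?andbT ?andbF.
Qed.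

Lemma allowed_arrow x : hvalid x -> allowed (hsrc x, [:: x]).
Proof. by rewrite allowed_cons eqxx allowed_nil => ->. Qed.

Lemma hcat_nill p v : hcat (v, [::]) p = p.
Proof. by case: p => u s; rewrite /hcat /= cats0. Qed.

End AllowedPaths.

Section PathBasis.
Variables (k : fieldType) (L : falgType k) (T : triple).
Local Notation G := (tG T).
Local Notation hpath := (hpath T).
Variables (b : hpath -> L) (ps : seq hpath).
Hypothesis ps_uniq : uniq ps.
Hypothesis mem_ps : forall p, (p \in ps) = allowed p.
Hypothesis b_basis : basis_of fullv [seq b p | p <- ps].
Hypothesis b_mul : forall p q, allowed p -> allowed q ->
  b p * b q = if (hend q == hstart p) && allowed (hcat p q)
              then b (hcat p q) else 0.
Implicit Types (p q : hpath) (Q R S : pred hpath).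

Let X := map_tuple b (in_tuple ps).

Let freeX : free X.
Proof. by have /andP[] := b_basis. Qed.

(* the coordinate along [b p]: for [p] in [ps] the sum has exactly one term *)
Definition coef p (x : L) : k := \sum_(i < size ps | nth p ps i == p) coord X i x.

Lemma coef_lin p (a : k) x y : coef p (a *: x + y) = a * coef p x + coef p y.
Proof.
by rewrite /coef mulr_sumr -big_split; apply: eq_bigr => i _; rewrite linearP.
Qed.

Lemma coef0 p : coef p 0 = 0.
Proof. by rewrite /coef big1 // => i _; rewrite linear0. Qed.

Lemma coefD p x y : coef p (x + y) = coef p x + coef p y.
Proof. by rewrite -[x]scale1r coef_lin mul1r scale1r. Qed.

Lemma coefZ p a x : coef p (a *: x) = a * coef p x.
Proof. by rewrite -[a *: x]addr0 coef_lin coef0 addr0. Qed.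

Lemma coef_sum p (I : Type) (r : seq I) (P : pred I) (F : I -> L) :
  coef p (\sum_(i <- r | P i) F i) = \sum_(i <- r | P i) coef p (F i).
Proof. exact: (big_morph (coef p) (coefD p) (coef0 p)). Qed.

Lemma coef_b p q : allowed q -> coef p (b q) = (p == q)%:R.
Proof.
rewrite -mem_ps => qps; have iq : (index q ps < size ps)%N by rewrite index_mem.
have cX i : coord X i (b q) = (Ordinal iq == i)%:R.
  by rewrite -(coord_free _ _ freeX) /= (nth_map q) // nth_index.
rewrite /coef (eq_bigr _ (fun i _ => cX i)); have [->|pq] := eqVneq p q.
  rewrite (bigD1 (Ordinal iq)) /= ?nth_index // eqxx big1 ?addr0 // => i /andP[_ iq'].
  by rewrite eq_sym (negPf iq').
rewrite big1 // => i /eqP ip; case: eqP => // iE.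
by case/eqP: pq; rewrite -ip -iE /= (set_nth_default q) // nth_index.
Qed.

Lemma coef_expand x : x = \sum_(p <- ps) coef p x *: b p.
Proof.
rewrite [LHS](coord_basis (X := X) b_basis (memvf x)) (big_tnth _ _ ps).
apply: eq_bigr => i _; set p := tnth _ i.
have pE d : nth d ps i = p by rewrite /p (tnth_nth d).
have -> : X`_i = b p by rewrite /= (nth_map p) // pE.
congr (_ *: _); rewrite /coef (bigD1 i) ?pE //= big1 ?addr0 // => j /andP[/eqP jp ji].
by case/eqP: ji; apply/ord_inj/eqP; rewrite -(nth_uniq p _ _ ps_uniq) // jp pE.
Qed.

Lemma coef_ext (g h : L -> k) :
  (forall (a : k) x y, g (a *: x + y) = a * g x + g y) ->
  (forall (a : k) x y, h (a *: x + y) = a * h x + h y) ->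
  (forall p, allowed p -> g (b p) = h (b p)) -> g =1 h.
Proof.
move=> glin hlin gh x; rewrite (coef_expand x).
have lin0 (l : L -> k) : (forall (a : k) x y, l (a *: x + y) = a * l x + l y) -> l 0 = 0.
  by move=> llin; have := llin (-1) 0 0; rewrite scaler0 add0r mulN1r addNr.
rewrite big_seq; apply: (big_ind (fun y => g y = h y)); first by rewrite !lin0.
  by move=> y z gy gz; rewrite -[y]scale1r glin hlin gy gz.
move=> p; rewrite mem_ps => okp; rewrite -[_ *: _]addr0 glin hlin gh //.
by rewrite !lin0.
Qed.

(** The radical, its powers and their corners all have this form, so inclusions reduce to
    implications between predicates and dimensions to counting. *)
Definition path_span Q : {vspace L} := <<[seq b p | p <- ps & Q p]>>%VS.

Lemma mem_path_span Q p : allowed p -> Q p -> b p \in path_span Q.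
Proof. by move=> okp Qp; rewrite memv_span // map_f // mem_filter Qp mem_ps. Qed.

Lemma path_spanP Q x :
  x \in path_span Q <-> forall p, allowed p -> ~~ Q p -> coef p x = 0.
Proof.
split=> [xQ p okp Qp|cx]; last first.
  rewrite (coef_expand x) big_seq memv_suml // => p; rewrite mem_ps => okp.
  have [Qp|Qp] := boolP (Q p); first by rewrite memvZ // mem_path_span.
  by rewrite cx // scale0r mem0v.
pose Y := in_tuple [seq b p | p <- ps & Q p].
rewrite (coord_span (xQ : x \in <<Y>>%VS)) coef_sum big1 // => i _; rewrite coefZ.
have /mapP[q + qE] : Y`_i \in [seq b p | p <- ps & Q p] by rewrite mem_nth.
rewrite qE mem_filter mem_ps => /andP[Qq okq]; rewrite coef_b //.
by case: eqP Qp => [->|]; rewrite ?Qq ?mulr0.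
Qed.

Lemma sub_path_span Q (V : {vspace L}) :
  (forall p, allowed p -> Q p -> b p \in V) -> (path_span Q <= V)%VS.
Proof.
move=> bV; apply/span_subvP => x /mapP[p + ->]; rewrite mem_filter mem_ps => /andP[Qp okp].
exact: bV.
Qed.

Lemma path_spanS Q R : (forall p, allowed p -> Q p -> R p) ->
  (path_span Q <= path_span R)%VS.
Proof. by move=> QR; apply: sub_path_span => p okp /(QR p okp); apply: mem_path_span. Qed.

Lemma path_spanU Q R : (path_span Q + path_span R)%VS = path_span (fun p => Q p || R p).
Proof.
apply: subv_anti; rewrite subv_add !path_spanS /=; last 2 first.
- by move=> p _ Rp; rewrite Rp orbT.
- by move=> p _ Qp; rewrite Qp.
apply: sub_path_span => p okp /orP[Qp|Rp].
  by apply: (subvP (addvSl _ _)); apply: mem_path_span.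
by apply: (subvP (addvSr _ _)); apply: mem_path_span.
Qed.

Lemma dim_path_span Q : \dim (path_span Q) = count Q ps.
Proof.
rewrite -size_filter -(size_map b); apply/eqP.
apply: (@catl_free _ _ [seq b p | p <- ps & predC Q p]).
by rewrite -map_cat (perm_free (perm_map b (permEl (perm_filterC Q ps)))).
Qed.

Lemma path_spanM Q R S :
  (forall p q, allowed p -> allowed q -> Q p -> R q -> hend q = hstart p ->
     allowed (hcat p q) -> S (hcat p q)) ->
  (path_span Q * path_span R <= path_span S)%VS.
Proof.
move=> QRS; apply/prodvP => u v /path_spanP uQ /path_spanP vR.
rewrite (coef_expand u) (coef_expand v) big_distrlr /= big_seq memv_suml // => p.
rewrite mem_ps => okp; rewrite big_seq memv_suml // => q; rewrite mem_ps => okq.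
rewrite -scalerAr -scalerAl.
have [Qp|/uQ->] := boolP (Q p); rewrite ?scale0r ?scaler0 ?mem0v //.
have [Rq|/vR->] := boolP (R q); rewrite ?scale0r ?mem0v //.
rewrite !memvZ // b_mul //; case: ifP => [/andP[/eqP qp okpq]|_]; last exact: mem0v.
by rewrite mem_path_span ?QRS.
Qed.

Lemma path_spanMr Q R S :
  (forall s, allowed s -> S s -> exists p q,
    [/\ allowed p, allowed q, Q p, R q & hend q = hstart p /\ s = hcat p q]) ->
  (path_span S <= path_span Q * path_span R)%VS.
Proof.
move=> QRS; apply: sub_path_span => s oks /(QRS s oks)[p [q [okp okq Qp Rq [qp sE]]]].
have -> : b s = b p * b q by rewrite b_mul // qp eqxx -sE oks.
by rewrite memv_mul ?mem_path_span.
Qed.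

(** * The frame formed by the trivial paths *)

Definition pe v : L := b (v, [::]).
Definition pf v : L -> k := coef (v, [::]).
Definition prad : {vspace L} := path_span (fun p => 0 < size p.2)%N.

Lemma pe_span v : <[pe v]>%VS = path_span (pred1 (v, [::])).
Proof.
apply: subv_anti; rewrite -memvE mem_path_span //=.
by apply: sub_path_span => p _ /eqP->; apply: memv_line.
Qed.

Lemma b_pe p v : allowed p -> b p * pe v = if p.1 == v then b p else 0.
Proof.
move=> okp; rewrite b_mul // /hend /hstart /= [v == _]eq_sym /hcat /=.
by case: eqP => [<-|//]; rewrite -surjective_pairing okp.
Qed.

Lemma pe_b p v : allowed p -> pe v * b p = if hend p == v then b p else 0.
Proof. by move=> okp; rewrite b_mul // hcat_nill okp andbT. Qed.

Lemma coef_pe p v x : allowed p -> coef p (x * pe v) = if p.1 == v then coef p x else 0.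
Proof.
move=> okp; pose g x := coef p (x * pe v).
apply: (@coef_ext g (fun x => if p.1 == v then coef p x else 0)) => [a y z|a y z|q okq].
- by rewrite /g mulrDl -scalerAl coef_lin.
- by case: ifP => _; rewrite ?coef_lin // mulr0 addr0.
rewrite /g b_pe // (fun_if (coef p)) coef0 coef_b //.
by have [->|] := eqVneq p q; rewrite // !if_same.
Qed.

(** A trivial path factors only into trivial paths. *)
Lemma pf_mul_b v p q : allowed p -> allowed q ->
  pf v (b p * b q) = ((v, [::]) == p)%:R * ((v, [::]) == q)%:R.
Proof.
move=> okp okq; rewrite /pf; have [<-|vp] := eqVneq (v, [::]) p.
  rewrite mul1r pe_b // (fun_if (coef _)) coef0 coef_b //.
  by case: (eqVneq (v, [::]) q) => [<-|_]; rewrite ?if_same //= eqxx.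
rewrite mul0r b_mul //; case: ifP => [/andP[/eqP qp okpq]|_]; last by rewrite coef0.
rewrite coef_b //; case: eqP => // -[vq].
case: p q {okp okq okpq} vp qp vq => [p1 p2] [q1 []] //=.
rewrite /hend /hstart xpair_eqE /= => /negP vp qp vq p20; case: vp.
by rewrite vq qp -p20 !eqxx.
Qed.

Lemma path_frame : frame pf pe prad.
Proof.
have pf_b v p : allowed p -> pf v (b p) = ((v, [::]) == p)%:R by move=> okp; apply: coef_b.
split.
- by move=> v a x y; apply: coef_lin.
- move=> v x y; rewrite {1}(coef_expand x) {1}(coef_expand y).
  have pfE z : pf v z = \sum_(p <- ps) coef p z * ((v, [::]) == p)%:R.
    rewrite {1}(coef_expand z) [LHS]coef_sum big_seq [RHS]big_seq.
    by apply: eq_bigr => p; rewrite mem_ps => okp; rewrite coefZ coef_b.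
  rewrite [in RHS]pfE (pfE y) !big_distrlr [LHS]coef_sum /= big_seq [RHS]big_seq.
  apply: eq_bigr => p; rewrite mem_ps => okp.
  rewrite coef_sum big_seq [RHS]big_seq; apply: eq_bigr => q; rewrite mem_ps => okq.
  rewrite -scalerAr -scalerAl !coefZ -/(pf v _) pf_mul_b //.
  by rewrite [RHS]mulrACA mulrA [coef q y * _]mulrC.
- by move=> v w; rewrite pf_b // xpair_eqE eqxx andbT.
- by move=> v w; rewrite pe_b // /hend /= eq_sym; case: eqP => [->|].
- suff one x : (\sum_v pe v) * x = x by rewrite -[LHS]mulr1 one.
  rewrite (coef_expand x) mulr_sumr big_seq [RHS]big_seq; apply: eq_bigr => p.
  rewrite mem_ps => okp; rewrite -scalerAr mulr_suml (bigD1 (hend p)) //= pe_b // eqxx.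
  by rewrite big1 ?addr0 // => v /negPf vp; rewrite pe_b // eq_sym vp.
- move=> x; split=> [/path_spanP cx v|fx]; first exact: cx.
  by apply/path_spanP => -[v [|a s]] // _ _; apply: fx.
(* One more than the maximal length, because [prad ^+ m.+1] is contained in the span of the paths
   longer than [m]. *)
pose N := (\max_(p <- ps) size p.2).+1; exists N; apply/eqP; rewrite -subv0.
have JN m : (prad ^+ m.+1 <= path_span (fun p => m < size p.2))%VS%N.
  elim: m => [|m IH]; first by rewrite expv1.
  rewrite expvSl (subv_trans (prodvSr _ IH)) // path_spanM // => p q _ _ p0 qm _ _.
  by rewrite size_cat -[m.+2]addn1 leq_add.
apply: subv_trans (JN _) _; apply: sub_path_span => p okp.
rewrite ltnNge => /negP[].
by apply: (leq_bigmax_seq (F := fun p : hpath => size p.2) p); rewrite ?mem_ps.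
Qed.

(** * Condition (F) for an algebra with a path basis *)

Hypothesis okT : triple_ok T.

(** Arrows not starting at [v] get [0], here and in [arrow_idem], so that all arrows of [G] can
    serve as indices: the extra summands of [pmod (arrow_idem v)] are zero. *)
Definition arrow_elt v a : L := if qsrc a == v then b (v, [:: inl a]) else 0.
Definition arrow_idem v a : L := if @qsrc G a == v then pe (qtgt a) else 0.

Lemma arrow_elt_idem v a : arrow_elt v a * pe v = arrow_elt v a.
Proof.
rewrite /arrow_elt; case: (eqVneq _ v) => [av|_]; last exact: mul0r.
by rewrite b_pe ?eqxx // allowed_cons /= av eqxx.
Qed.

Lemma arrow_elt_idem_l v a : arrow_idem v a * arrow_elt v a = arrow_elt v a.
Proof.
rewrite /arrow_elt /arrow_idem; case: (eqVneq _ v) => [av|_]; last exact: mul0r.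
by rewrite pe_b ?eqxx // allowed_cons /= av eqxx.
Qed.

Lemma arrow_elt_rad v a : arrow_elt v a \in prad.
Proof.
rewrite /arrow_elt; case: (eqVneq _ v) => [av|_]; last exact: mem0v.
by rewrite mem_path_span // allowed_cons /= av eqxx.
Qed.

(** A nontrivial path out of [v] factors through its first arrow, which is old because [v] is
    outside [D]. *)
Lemma rad_arrow_gen v y : v \notin tD T -> y \in prad ->
  exists c : 'I_(na G) -> L, y * pe v = \sum_a c a * arrow_elt v a.
Proof.
move=> vD yJ.
have : y * pe v \in (\sum_a fullv * <[arrow_elt v a]>)%VS.
  rewrite (coef_expand (y * pe v)) big_seq memv_suml // => p; rewrite mem_ps => okp.
  rewrite coef_pe //; case: (eqVneq p.1 v) => [pv|_]; last by rewrite scale0r mem0v.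
  case: p okp pv => u [|[a|d] s] okp /= uv; rewrite {u}uv in okp *.
  - by move/path_spanP: yJ => -> //; rewrite scale0r mem0v.
  - rewrite memvZ //; apply: (subvP (sumv_sup a _ (subvv _))) => //.
    move: (okp); rewrite allowed_cons => /and4P[_ /= av oks _].
    have -> : b (v, inl a :: s) = b (qtgt a, s) * arrow_elt v a.
      rewrite /arrow_elt av b_mul ?allowed_cons ?av //.
      by rewrite /hend /= eqxx oks orbT.
    by rewrite memv_mul ?memvf ?memv_line.
  by move: okp; rewrite allowed_cons => /and4P[/= dD /eqP dv]; rewrite -dv dD in vD.
move=> /memv_sumP[d dP ->].
have /choice[c cP] : forall a, exists c, d a = c * arrow_elt v a.
  by move=> a; have /memv_mul_line[c _ ->] := dP a isT; exists c.
by exists c; apply: eq_bigr => a _; rewrite cP.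
Qed.

(** Right cancellation: a path determines its first arrow and what remains after it. *)
Lemma coef_arrow v a a' s y : qsrc a = v -> allowed (qtgt a, s) ->
  coef (v, inl a :: s) (y * arrow_elt v a') = if a' == a then coef (qtgt a, s) y else 0.
Proof.
move=> av oks; pose g y := coef (v, inl a :: s) (y * arrow_elt v a').
pose h y := if a' == a then coef (qtgt a, s) y else 0.
apply: (@coef_ext g h) => [c x z|c x z|q okq].
- by rewrite /g mulrDl -scalerAl coef_lin.
- by rewrite /h; case: ifP => _; rewrite ?coef_lin // mulr0 addr0.
rewrite /g /h /arrow_elt; case: (eqVneq _ v) => [av'|av']; last first.
  rewrite mulr0 coef0; case: eqP => // aa'; by rewrite aa' av eqxx in av'.
rewrite b_mul //; last by rewrite allowed_cons /= av' eqxx.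
rewrite {1}/hend /hstart /hcat /= allowed_cons /= av' eqxx orbT andbT /=.
rewrite (fun_if (coef _)) coef0 (coef_b (qtgt a, s)) //.
case: (eqVneq (qtgt a') q.1) => [aq|aq] /=; last first.
  by case: eqP => // aa'; case: eqP => // qE; rewrite -qE aa' eqxx in aq.
rewrite aq -surjective_pairing okq coef_b; last first.
  by rewrite allowed_cons /= av' eqxx aq -surjective_pairing okq orbT.
rewrite xpair_eqE eqxx eqseq_cons -[inl a == _]/(a == a') /= [a == a']eq_sym.
case: eqP => //= [aa'].
by case: q aq {okq} => q1 q2 /= <-; rewrite xpair_eqE aa' eqxx.
Qed.

Lemma rad_arrow_free v (c : 'I_(na G) -> L) :
  \sum_a c a * arrow_elt v a = 0 -> forall a, c a * arrow_idem v a = 0.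
Proof.
move=> c0 a; rewrite /arrow_idem; case: (eqVneq _ v) => [av|_]; last exact: mulr0.
rewrite (coef_expand (c a * _)) big_seq big1 // => p; rewrite mem_ps => okp.
rewrite coef_pe //; case: (eqVneq p.1 _) => [pa|_]; last exact: scale0r.
have := congr1 (coef (v, inl a :: p.2)) c0; rewrite coef0 coef_sum (bigD1 a) //=.
rewrite coef_arrow -?pa -?surjective_pairing // eqxx big1 ?addr0 => [->|a' /negPf aa'].
  by rewrite scale0r.
by rewrite coef_arrow -?pa -?surjective_pairing // aa'.
Qed.

(** A vertex of [D] is a sink of [G] and its new arrow cannot be continued, so that arrow is the
    only nontrivial path out of [v]. *)
Lemma rad_new_arrow v y : v \in tD T -> y \in prad ->
  exists l : k, y * pe v = l *: b (v, [:: inr v]).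
Proof.
move=> vD yJ.
apply/vlineP; rewrite (coef_expand (y * pe v)) big_seq memv_suml // => p.
rewrite mem_ps => okp; rewrite coef_pe //.
case: (eqVneq p.1 v) => [pv|_]; last by rewrite scale0r mem0v.
case: p okp pv => u [|[a|d] s] okp /= uv; rewrite {u}uv in okp *.
- by move/path_spanP: yJ => -> //; rewrite scale0r mem0v.
- move: okp; rewrite allowed_cons => /and4P[_ /= av _ _].
  by have [_ [/(_ v vD)/forallP/(_ a)]] := okT; rewrite av.
move: okp; rewrite allowed_cons orbF => /and4P[_ /eqP /= -> _ /eqP ->].
by rewrite memvZ ?memv_line.
Qed.

(** The module [P] is a copy of some [L e_v]. Its radical is a line if [v] is in [D], and otherwise
    the direct sum of the [L e_(t a)] over the arrows [a] out of [v]. *)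
Lemma path_condF : condF L.
Proof.
have FF := path_frame.
move=> P fgP projP indP.
have [v [x0 [ex0 x0n0 gen0 free0]]] := indecomposable_projective_cyclic FF fgP projP indP.
have radP (p : P) := cyclic_rad FF ex0 x0n0 gen0 p.
have pe_x0 c : (c * pe v) *: x0 = c *: x0 by rewrite -scalerA ex0.
have [vD|vD] := boolP (v \in tD T); [right | left].
  pose al := b (v, [:: inr v]).
  have okv : allowed (v, [:: inr v] : seq (harrow T)) by rewrite allowed_cons /= vD eqxx.
  have alJ : al \in prad by rewrite mem_path_span.
  have line c : c \in prad -> exists l : k, c *: x0 = (l *: al) *: x0.
    by move=> /(rad_new_arrow vD)[l lE]; exists l; rewrite -lE pe_x0.
  split.
    split; first by apply/radP; exists 0; rewrite ?mem0v ?scale0r.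
    split=> [_ _ /radP[c cJ ->] /radP[d dJ ->]|a _ /radP[c cJ ->]]; apply/radP.
      by exists (c + d); rewrite ?memvD ?scalerDl.
    by exists (a * c); rewrite ?(frame_rad_mull FF) ?scalerA.
  split.
    exists (al *: x0); split; first by apply/radP; exists al.
    apply/eqP => /free0; rewrite b_pe // eqxx => al0.
    have := coef_b (v, [:: inr v]) okv; rewrite al0 coef0 eqxx => /esym/eqP.
    by rewrite oner_eq0.
  move=> S [S0 [SD SZ]] Srad; have [|nS] := pselect (forall x, S x -> x = 0); first by left.
  right=> x /radP[c cJ ->]; apply: contrapT => nSc; apply: nS => y Sy.
  have /radP[d dJ yE] := Srad y Sy; have [l dE] := line d dJ.
  have [l0|l0] := eqVneq l 0; first by rewrite yE dE l0 !scale0r.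
  have [m cE] := line c cJ; case: nSc; rewrite cE.
  (* Both vectors lie on the line through [al *: x0], and [y] has the nonzero coordinate [l]. *)
  have -> : (m *: al) *: x0 = (m / l)%:A *: y.
    by rewrite yE dE scalerA mulr_algl scalerA mulfVK.
  exact: SZ.
have idem a : arrow_idem v a * arrow_idem v a = arrow_idem v a.
  by rewrite /arrow_idem; case: ifP; rewrite ?mulr0 // (frame_idem FF).
pose j : {linear pmod (arrow_idem v) -> P} := combo (fun a => arrow_elt v a *: x0) \o val.
exists (pmod (arrow_idem v)), j.
have jE c : j c = (\sum_a (val c a : L) * arrow_elt v a) *: x0.
  by rewrite scaler_suml; apply: eq_bigr => a _; rewrite scalerA.
have j0 c : j c = 0 -> c = 0.
  rewrite jE => /free0; rewrite mulr_suml => c0.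
  apply: val_inj; apply/ffunP => a; rewrite -pmodP [RHS]ffunE.
  apply: (rad_arrow_free (c := fun a => val c a)); rewrite -[RHS]c0.
  by apply: eq_bigr => i _; rewrite -mulrA arrow_elt_idem.
split; last split.
- move=> c d cd; apply/eqP; rewrite -subr_eq0; apply/eqP/j0.
  by rewrite linearB cd subrr.
- exact: pmod_projective.
move=> y; split=> [/radP[c cJ ->]|[c ->]].
  have [d dE] := rad_arrow_gen vD cJ.
  have dP : pmod_pred (arrow_idem v) [ffun a => d a * arrow_idem v a : L^o].
    by apply/forallP => a; rewrite !ffunE -mulrA idem.
  exists (Pmod dP); rewrite jE -pe_x0 dE; congr (_ *: _); apply: eq_bigr => a _ /=.
  by rewrite ffunE -mulrA arrow_elt_idem_l.
rewrite jE; apply/radP; eexists; last reflexivity.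
by apply: memv_suml => a _; rewrite (frame_rad_mull FF) // arrow_elt_rad.
Qed.

(** * Powers of the radical and the invariants they yield *)

Lemma prad_mul m :
  (path_span (fun p => m < size p.2)%N * prad)%VS = path_span (fun p => m.+1 < size p.2)%N.
Proof.
apply: subv_anti; rewrite path_spanM /= => [|p q _ _ pm q0 _ _]; last first.
  by rewrite size_cat -[m.+2]add1n leq_add.
apply: path_spanMr => -[v [|x s]] //=; rewrite allowed_cons => /and4P[xok /eqP xv oks _] ms.
exists (htgt x, s), (v, [:: x]); split=> //.
by rewrite -xv allowed_arrow.
Qed.

Lemma prad2 : (prad * prad)%VS = path_span (fun p => 1 < size p.2)%N.
Proof. exact: prad_mul. Qed.

Lemma prad3 : (prad * prad * prad)%VS = path_span (fun p => 2 < size p.2)%N.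
Proof. by rewrite prad2 prad_mul. Qed.

Lemma path_span_pe Q v :
  (path_span Q * <[pe v]>)%VS = path_span (fun p => Q p && (p.1 == v)).
Proof.
rewrite pe_span; apply: subv_anti; rewrite path_spanM => [|p q _ _ Qp /eqP-> vp _] /=.
  apply: path_spanMr => p okp /andP[Qp /eqP pv]; exists p, (v, [::]).
  by rewrite /= Qp eqxx; split=> //; split=> //; rewrite -pv /hcat; case: (p).
by move: vp; rewrite /hend /hcat /= => ->; rewrite -surjective_pairing Qp eqxx.
Qed.

Lemma pe_path_span Q v :
  (<[pe v]> * path_span Q)%VS = path_span (fun p => Q p && (hend p == v)).
Proof.
rewrite pe_span; apply: subv_anti; rewrite path_spanM => [|p q _ _ /eqP-> Qq qv _] /=.
  apply: path_spanMr => p okp /andP[Qp /eqP pv]; exists (v, [::]), p.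
  by rewrite /= Qp eqxx hcat_nill.
by rewrite hcat_nill Qq qv eqxx.
Qed.

Definition arrows_between v w :=
  [set x : harrow T | [&& hvalid x, hsrc x == v & htgt x == w]].

Lemma count_arrows v w :
  count (fun p : hpath => [&& size p.2 == 1%N, p.1 == v & hend p == w]) ps =
  #|arrows_between v w|.
Proof.
rewrite cardE -size_filter -(size_map (fun x => (hsrc x, [:: x]) : hpath)).
apply/perm_size/uniq_perm; first exact: filter_uniq.
  by rewrite map_inj_uniq ?enum_uniq // => x y [].
move=> [u s]; rewrite mem_filter mem_ps /=; apply/andP/mapP => [[/and3P[]]|[x]].
  case: s => [|x []] //= _ /eqP-> /eqP xw; rewrite allowed_cons => /and4P[xok /eqP xv _ _].
  by exists x; rewrite ?xv // mem_enum inE xok xv eqxx -xw eqxx.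
rewrite mem_enum inE => /and3P[xok /eqP xv /eqP xw] [-> ->] /=.
by rewrite xv eqxx -{1}xw eqxx -xv allowed_arrow.
Qed.

(** Modulo the paths of length at least two, the corner retains exactly the arrows from [v] to
    [w]. *)
Lemma dim_rad_corner v w :
  \dim (prad * prad + <[pe w]> * prad * <[pe v]>) =
  (\dim (prad * prad) + #|arrows_between v w|)%N.
Proof.
rewrite prad2 pe_path_span path_span_pe path_spanU !dim_path_span -count_arrows.
elim: ps => //= p r ->; rewrite !addnA; congr (_ + _)%N; rewrite addnAC; congr (_ + _)%N.
by case: p => u [|x [|y s]] //=; rewrite andbC.
Qed.

(** No allowed path of length two starts in [D]. Outside [D], two consecutive arrows [x], [y] form
    an allowed path of length two, whose basis element is not in the cube of the radical. *)
Lemma mem_tD v : v \in tD T <->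
  (prad * prad * <[pe v]> <= prad * prad * prad)%VS /\
  exists w u, arrows_between v w != set0 /\ arrows_between w u != set0.
Proof.
have [_ [sinkD rhoD]] := okT.
rewrite prad3 prad2 path_span_pe; split=> [vD|[sub [w [u [/set0Pn[x xvw] /set0Pn[y ywu]]]]]].
  split.
    apply: path_spanS => -[v' [|x [|y s]]] //; rewrite !allowed_cons /=.
    move=> /and4P[_ xv _ xold] /eqP vv'; case: x xv xold => [a|d] //= av _.
    by have /forallP/(_ a) := sinkD v vD; rewrite -vv' av.
  exists (trho T v).
  have inv : inr v \in arrows_between v (trho T v) by rewrite inE /= vD !eqxx.
  (* Some arrow leaves [rho v]: the new one if [rho v] is a sink of [G], hence in [D], and an old
     one otherwise. *)
  have [/(rhoD _ vD) rD|nsink] := boolP (sink (trho T v)).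
    exists (trho T (trho T v)); split; apply/set0Pn; first by exists (inr v).
    by exists (inr (trho T v)); rewrite inE /= rD !eqxx.
  move: nsink; rewrite negb_forall => /existsP[a]; rewrite negbK => /eqP av.
  exists (qtgt a); split; apply/set0Pn; first by exists (inr v).
  by exists (inl a); rewrite inE /= av !eqxx.
apply: contrapT => vD; move: xvw ywu; rewrite !inE.
move=> /and3P[xok /eqP xv /eqP xw] /and3P[yok /eqP yw /eqP yu].
have okp : allowed (v, [:: x; y]).
  rewrite !allowed_cons xok yok xv xw yw !eqxx allowed_nil /=.
  by case: x xok xv {xw} => //= d dD dv; case: vD; rewrite -dv.
have /(subvP sub)/path_spanP/(_ _ okp isT) : b (v, [:: x; y]) \in
    path_span (fun p => (1 < size p.2)%N && (p.1 == v)) by rewrite mem_path_span //= eqxx.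
by rewrite coef_b // eqxx => /eqP; rewrite oner_eq0.
Qed.

End PathBasis.

(** * The triple of an algebra satisfying (F) *)

Section Reconstruction.
Variables (k : fieldType) (L : falgType k).
Variables (n : nat) (f : 'I_n -> L -> k) (e : 'I_n -> L) (J : {vspace L}).
Hypothesis FF : frame f e J.
Variables (m : nat) (src tgt : 'I_m -> 'I_n) (el : 'I_m -> L).
Variables (D : {set 'I_n}) (rho : 'I_n -> 'I_n) (al : 'I_n -> L).
Hypothesis srcD : forall a, src a \notin D.
Hypothesis elP : forall a,
  [/\ el a \in J, e (tgt a) * el a = el a & el a * e (src a) = el a].
Hypothesis el_gen : forall v y, v \notin D -> y \in J ->
  exists c : 'I_m -> L, y * e v = \sum_(a | src a == v) c a * el a.
Hypothesis el_free : forall v (c : 'I_m -> L),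
  \sum_(a | src a == v) c a * el a = 0 -> forall a, src a = v -> c a * e (tgt a) = 0.
Hypothesis alP : forall d, d \in D ->
  [/\ al d \in J, al d != 0, e (rho d) * al d = al d & al d * e d = al d].
Hypothesis rad_al : forall d y, d \in D -> y \in J -> y * al d = 0.
Hypothesis al_gen : forall d y, d \in D -> y \in J -> exists l : k, y * e d = l *: al d.
Hypothesis rho_sink : forall d, d \in D -> rho d \notin D -> exists a, src a = rho d.

Definition rtriple : triple := @Triple (Quiver src tgt) D rho.
Local Notation T := rtriple.
Local Notation harrow := (harrow T).

(** This weight controls acyclicity, the length of allowed paths and the induction in [rb_span]. *)
Let wt v := \dim (fullv * <[e v]>)%VS.

(** Right multiplication by [el a] embeds [L e_(tgt a)] into [J e_(src a)], which is proper in
    [L e_(src a)] since the character at [src a] vanishes on it. *)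
Lemma wt_arrow a : (wt (tgt a) < wt (src a))%N.
Proof.
pose U := (fullv * <[e (tgt a)]>)%VS; have [aJ ea ae] := elP a.
have injU : (U :&: lker (amulr (el a)))%VS = 0%VS.
  apply/eqP; rewrite -subv0; apply/subvP => z; rewrite memv_cap memv_ker lfunE /=.
  move=> /andP[/memv_mul_line[y _ ->]] /eqP ya; rewrite memv0; apply/eqP.
  have := @el_free (src a) (fun a' => if a' == a then y else 0) _ a erefl.
  rewrite eqxx; apply; rewrite (bigD1 a) //= eqxx big1 ?addr0 => [|a' /andP[_ /negPf->]].
    by rewrite -ea mulrA.
  by rewrite mul0r.
rewrite /wt -(limg_dim_eq injU).
have sub : (amulr (el a) @: U <= J * <[e (src a)]>)%VS.
  apply/subvP => _ /memv_imgP[z _ ->]; rewrite lfunE /= -ae mulrA.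
  by rewrite memv_mul ?memv_line ?(frame_rad_mull FF).
apply: leq_ltn_trans (dimvS sub) _.
have subf : (J * <[e (src a)]> <= fullv * <[e (src a)]>)%VS by rewrite prodvSl ?subvf.
rewrite ltn_neqAle dimvS // andbT; apply/eqP => E.
have /eqP EJ : (J * <[e (src a)]> == fullv * <[e (src a)]>)%VS by rewrite eqEdim subf E /=.
have : 1 * e (src a) \in (J * <[e (src a)]>)%VS by rewrite EJ memv_mul ?memvf ?memv_line.
move=> /memv_mul_line[j jJ] /(congr1 (f (src a))).
rewrite !(frame_mul_idem FF) eqxx (frame1 FF) ((frame_radP FF j).1 jJ) => /eqP.
by rewrite oner_eq0.
Qed.

Lemma gend_wt v (s : seq 'I_m) : @gpath_ok (tG T) v s -> s != [::] ->
  (wt (@gend (tG T) v s) < wt v)%N.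
Proof.
elim: s v => // a s IHs v /andP[/eqP /= av pas] _.
have [->|s0] := eqVneq s [::]; first by rewrite -av /gend /=; apply: wt_arrow.
have := IHs (tgt a); rewrite /gend /= => /(_ _ s0) lt; apply: ltn_trans (lt _) _.
  by case: s pas {IHs s0 lt} => //= a' s /andP[/eqP-> ->]; rewrite eqxx.
by rewrite -av; apply: wt_arrow.
Qed.

Lemma rtriple_ok : triple_ok T.
Proof.
split=> [v s ok s0|]; first by apply: contraTneq (gend_wt ok s0) => ->; rewrite ltnn.
split=> d dD; first by apply/forallP => a; apply: contraTneq dD => <-; apply: srcD.
move=> /forallP sk; apply: contrapT => /negP /(rho_sink dD)[a aE].
by have := sk a; rewrite /= aE eqxx.
Qed.

Definition elt (x : harrow) : L := match x with inl a => el a | inr d => al d end.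

(** The first arrow is the rightmost factor, so the recursion matches cancellation on the right. *)
Fixpoint bs v (s : seq harrow) : L :=
  if s is x :: s' then bs (htgt x) s' * elt x else e v.

Definition rb (p : hpath T) : L := bs p.1 p.2.

Lemma eltP (x : harrow) : hvalid x ->
  [/\ elt x \in J, e (htgt x) * elt x = elt x & elt x * e (hsrc x) = elt x].
Proof. by case: x => [a _|d /alP[]]; [apply: elP | split]. Qed.

Lemma bs_src v s : @allowed T (v, s) -> bs v s * e v = bs v s.
Proof.
case: s => [|x s]; first by rewrite (frame_idem FF).
rewrite allowed_cons => /and4P[/eltP[_ _ xe] /eqP <- _ _].
by rewrite /= -mulrA xe.
Qed.

Lemma bs_rad v x s : @allowed T (v, x :: s) -> bs v (x :: s) \in J.
Proof.
rewrite allowed_cons => /and4P[/eltP[xJ _ _] _ _ _].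
by rewrite /= (frame_rad_mull FF).
Qed.

(** Induction on the right factor. The forbidden products, in which a new arrow is continued, vanish
    because [J] annihilates [al d] from the left. *)
Lemma rb_mul (p q : hpath T) : allowed p -> allowed q ->
  rb p * rb q = if (hend q == hstart p) && allowed (hcat p q) then rb (hcat p q) else 0.
Proof.
case: p q => u t [v s] okp; elim: s v => [|x s IHs] v.
  move=> _; rewrite /hend /hstart /hcat /rb /=.
  case: (eqVneq v u) => [->|vu]; first by rewrite okp (bs_src okp).
  by rewrite -(bs_src okp) -mulrA (frame_orth FF) eq_sym (negPf vu) mulr0.
rewrite allowed_cons => /and4P[xok /eqP xv oks xs].
rewrite /rb /= mulrA [X in X * _](IHs _ oks) /hend /hstart /hcat /=.
rewrite allowed_cons xok xv eqxx /=.
case: eqP => [E|_] /=; last by rewrite mul0r.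
case: (boolP (allowed (htgt x, s ++ t))) => [okst|_] /=; last by rewrite mul0r.
case: x xok xv xs E oks okst {IHs} => [a|d] /=; first by rewrite !orbT.
rewrite !orbF => dD _ /eqP-> /= E _ okt.
case: t okp okt => [|y t] okp okt //=.
by rewrite -[LHS]/(bs (rho d) (y :: t) * al d) rad_al // bs_rad.
Qed.

(** As [L e_v] is the direct sum of [k e_v] and the [L (el a')] over the arrows out of [v], [pi] can
    read off the coefficient at [el a], cut down by [e (tgt a)]. Freeness makes the relation [R]
    single-valued. *)
Lemma arrow_coordinate a : exists pi : L -> L,
  [/\ forall (c : k) y z, pi (c *: y + z) = c *: pi y + pi z,
      forall y, y * e (src a) = 0 -> pi y = 0, pi (e (src a)) = 0 &
      forall y a', src a' = src a ->
        pi (y * el a') = if a' == a then y * e (tgt a) else 0].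
Proof.
set v := src a.
pose R y z := exists2 c : 'I_m -> L,
  y * e v - f v y *: e v = \sum_(a' | src a' == v) c a' * el a' & z = c a * e (tgt a).
have Rex y : exists z, R y z.
  have [c cE] := el_gen (srcD a) (frame_corner FF v y).
  exists (c a * e (tgt a)); exists c => //; rewrite -cE.
  by rewrite mulrBl -mulrA -scalerAl (frame_idem FF).
have Runi y z z' : R y z -> R y z' -> z = z'.
  move=> [c cE ->] [c' c'E ->]; apply/eqP; rewrite -subr_eq0 -mulrBl; apply/eqP.
  apply: (@el_free v (fun a => c a - c' a)) => //.
  rewrite (eq_bigr (fun a => c a * el a - c' a * el a)) => [|i _]; last by rewrite mulrBl.
  by rewrite sumrB -cE -c'E subrr.
have [pi piR] := choice Rex; exists pi.
have R0 : R 0 0.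
  exists (fun=> 0); last by rewrite mul0r.
  by rewrite mul0r (frame0 FF) scale0r subr0 big1 // => i _; rewrite mul0r.
split=> [c y z|y yv||y a' a'v].
- apply: Runi (piR _) _; have [[cy yE ->] [cz zE ->]] := (piR y, piR z).
  exists (fun a => c *: cy a + cz a); last by rewrite mulrDl scalerAl.
  rewrite (eq_bigr (fun a => c *: (cy a * el a) + cz a * el a)); last first.
    by move=> i _; rewrite mulrDl scalerAl.
  rewrite big_split /= -scaler_sumr -yE -zE (frameD FF) (frameZ FF) mulrDl -scalerAl.
  by rewrite scalerBr scalerA scalerDl opprD addrACA.
- apply: Runi (piR _) _; have [c cE zE] := R0; exists c => //; rewrite -cE.
  have fy : f v y = 0.
    by apply/eqP; rewrite -(frame_rad_idem FF) yv mem0v.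
  by rewrite yv fy mul0r (frame0 FF) !scale0r subr0.
- apply: Runi (piR _) _; have [c cE zE] := R0; exists c => //; rewrite -cE.
  rewrite (frame_idem FF) (frame_char FF) eqxx scale1r subrr.
  by rewrite mul0r (frame0 FF) !scale0r subr0.
apply: Runi (piR _) _; exists (fun i => if i == a' then y else 0); last first.
  by rewrite eq_sym; case: eqP => // _; rewrite mul0r.
have [aJ ea ae] := elP a'.
rewrite (bigD1 a') ?a'v //= eqxx big1 ?addr0 => [|i /andP[_ /negPf->]]; last by rewrite mul0r.
rewrite (frameM FF) ((frame_radP FF _).1 aJ) mulr0 scale0r subr0 -mulrA.
by rewrite -a'v ae.
Qed.

(** The analogue at a vertex of [D], where [L e_d] is spanned over [k] by [e d] and [al d]. *)
Lemma new_arrow_coordinate d : d \in D -> exists lam : L -> k,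
  [/\ forall (c : k) y z, lam (c *: y + z) = c * lam y + lam z,
      forall y, y * e d = 0 -> lam y = 0, lam (e d) = 0 & lam (al d) = 1].
Proof.
move=> dD; have [aJ a0 ea ae] := alP dD.
pose R y l := y * e d - f d y *: e d = l *: al d.
have Rex y : exists l, R y l.
  have [l lE] := al_gen dD (frame_corner FF d y); exists l; rewrite /R -lE.
  by rewrite mulrBl -mulrA -scalerAl (frame_idem FF).
have Runi y l l' : R y l -> R y l' -> l = l'.
  rewrite /R => -> /eqP; rewrite -subr_eq0 -scalerBl scaler_eq0 (negPf a0) orbF subr_eq0.
  by move/eqP.
have [lam lamR] := choice Rex; exists lam; split=> [c y z|y yd||].
- apply: Runi (lamR _) _; rewrite /R scalerDl -scalerA -(lamR y) -(lamR z).
  rewrite (frameD FF) (frameZ FF) mulrDl -scalerAl.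
  by rewrite scalerBr scalerA scalerDl opprD addrACA.
- apply: Runi (lamR _) _; have fy : f d y = 0.
    by apply/eqP; rewrite -(frame_rad_idem FF) yd mem0v.
  by rewrite /R yd fy !scale0r subr0.
- apply: Runi (lamR _) _.
  by rewrite /R (frame_idem FF) (frame_char FF) eqxx scale1r subrr scale0r.
apply: Runi (lamR _) _.
by rewrite /R ((frame_radP FF _).1 aJ) scale0r subr0 ae scale1r.
Qed.

(* The dual basis of the path basis: [kap (v, x1 :: ... :: xr)] strips the arrows
   [x1, ..., xr] off the right of its argument. *)
Lemma dual_path_basis : exists kap : hpath T -> L -> k,
  (forall p (c : k) y z, kap p (c *: y + z) = c * kap p y + kap p z) /\
  forall p q, allowed p -> allowed q -> kap p (rb q) = (p == q)%:R.
Proof.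
have [pi piP] := choice arrow_coordinate.
have /choice[lam lamP] : forall d, exists lam : L -> k, d \in D ->
  [/\ forall (c : k) y z, lam (c *: y + z) = c * lam y + lam z,
      forall y, y * e d = 0 -> lam y = 0, lam (e d) = 0 & lam (al d) = 1].
  move=> d; have [/new_arrow_coordinate[l lP]|_] := boolP (d \in D); first by exists l.
  by exists (fun=> 0).
(* The recursion stops at a new arrow, which ends every allowed path containing it. *)
pose fix kp v (s : seq harrow) (y : L) {struct s} : k :=
  match s with
  | [::] => f v y
  | inl a :: s' => kp (tgt a) s' (pi a y)
  | inr d :: _ => if d \in D then lam d y else 0
  end.
have kplin v s (c : k) y z : kp v s (c *: y + z) = c * kp v s y + kp v s z.
  elim: s v y z => [|[a|d] s IHs] v y z /=; first exact: (frame_lin FF).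
    by have [-> _ _ _] := piP a; apply: IHs.
  by case: ifP => [/lamP[-> _ _ _]//|_]; rewrite mulr0 addr0.
have kp0 v s : kp v s 0 = 0.
  by have := kplin v s (-1) 0 0; rewrite scaler0 add0r mulN1r addNr.
exists (fun p => kp p.1 p.2); split=> [p|[u s] [v t]] /=; first exact: kplin.
elim: s u v t => [|x s IHs] u v t.
  case: t => [|y t] _ okt; first by rewrite /rb /= (frame_char FF) xpair_eqE eqxx andbT.
  rewrite [LHS](_ : _ = 0); last by apply: (frame_radP FF _).1; apply: bs_rad.
  by rewrite xpair_eqE andbF.
rewrite allowed_cons => /and4P[xok /eqP xu oks xs] okt.
have out : u != v -> rb (v, t) * e u = 0.
  by move=> uv; rewrite /rb /= -(bs_src okt) -mulrA (frame_orth FF) eq_sym (negPf uv) mulr0.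
case: x xok xu oks xs => [a|d] /= xok xu oks xs.
  have [_ piout pie piel] := piP a.
  have [uv|uv] := eqVneq u v; last by rewrite piout ?kp0 ?xpair_eqE ?(negPf uv) // xu out.
  rewrite -uv in okt *; rewrite xpair_eqE eqxx /=.
  case: t okt {out} => [|[a'|d] t]; first by rewrite /rb /= -xu pie kp0.
    rewrite allowed_cons => /and4P[_ /eqP /= a'u okt _].
    rewrite /rb /= piel ?a'u //; rewrite eqseq_cons -[inl a == _]/(a == a') eq_sym.
    case: eqP => [E|_] /=; last by rewrite kp0.
    by rewrite -E in okt *; rewrite (bs_src okt) [LHS](IHs _ _ t oks okt) xpair_eqE eqxx.
  by rewrite allowed_cons => /and4P[/= dD /eqP /= du]; have := srcD a; rewrite xu -du dD.
rewrite xok; have [_ lout lame lamal] := lamP d xok.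
rewrite orbF in xs; rewrite (eqP xs) {s xs IHs oks}.
have [uv|uv] := eqVneq u v; last by rewrite lout ?xpair_eqE ?(negPf uv) // xu out.
rewrite -uv in okt *; rewrite xpair_eqE eqxx /=.
case: t okt {out} => [|[a'|d'] t]; first by rewrite /rb /= -xu lame.
  by rewrite allowed_cons => /and4P[_ /eqP /= a'u]; have := srcD a'; rewrite a'u -xu xok.
rewrite allowed_cons orbF => /and4P[_ /eqP /= d'u _ /eqP->].
have [_ _ ra _] := alP xok.
by rewrite d'u -xu /rb /= ra lamal eqxx.
Qed.

(** The weight drops along old arrows; the successor accounts for a final new arrow. *)
Lemma allowed_size (p : hpath T) : allowed p -> (size p.2 <= (\dim {:L}).+1)%N.
Proof.
suff size_wt v s : @allowed T (v, s) -> (size s <= (wt v).+1)%N.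
  by case: p => v s /size_wt/leq_trans -> //; rewrite ltnS dimvS ?subvf.
elim: s v => // x s IHs v; rewrite allowed_cons => /and4P[_ /eqP <- /IHs].
case: x => [a /= lt _|d _]; first by rewrite ltnS (leq_trans lt) // wt_arrow.
by rewrite orbF => /eqP->.
Qed.

Lemma allowed_enum : exists ps : seq (hpath T),
  uniq ps /\ forall p, (p \in ps) = allowed p.
Proof.
pose B := (\dim {:L}).+1.
pose all_seqs := flatten [seq [seq tval t | t <- enum {: l.-tuple harrow}] | l <- iota 0 B.+1].
exists (undup [seq p <- [seq (v, s) | v <- enum 'I_n, s <- all_seqs] | allowed (p : hpath T)]).
rewrite undup_uniq; split=> // -[v s]; rewrite mem_undup mem_filter andb_idr // => oks.
apply: allpairs_f; first by rewrite mem_enum.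
apply/flattenP; exists [seq tval t | t <- enum {: (size s).-tuple harrow}].
  by apply/mapP; exists (size s) => //; rewrite mem_iota add0n ltnS (allowed_size oks).
by apply/mapP; exists (in_tuple s); rewrite ?mem_enum.
Qed.

Lemma free_dual (I : eqType) (r : seq I) (g : I -> L) (kap : I -> L -> k) :
  uniq r -> (forall i (c : k) y z, kap i (c *: y + z) = c * kap i y + kap i z) ->
  {in r &, forall i j, kap i (g j) = (i == j)%:R} -> free [seq g i | i <- r].
Proof.
move=> ur kl kg; elim: r ur kg => [|i r IHr] /=; first by rewrite nil_free.
move=> /andP[ir ur] kg; rewrite free_cons IHr ?andbT // => [|i' j' i'r j'r]; last first.
  by rewrite kg // inE ?i'r ?j'r orbT.
apply/negP => gr; have k0 : kap i 0 = 0.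
  by have := kl i (-1) 0 0; rewrite scaler0 add0r mulN1r addNr.
have /eqP : kap i (g i) = 0; last by rewrite kg ?mem_head // eqxx oner_eq0.
pose Y := in_tuple [seq g j | j <- r].
rewrite (coord_span (gr : g i \in <<Y>>%VS)).
apply: (big_ind (fun y => kap i y = 0)) => // [y z yE zE|j _].
  by rewrite -[y]scale1r kl yE zE mulr0 addr0.
rewrite -[_ *: _]addr0 kl k0 addr0.
have /mapP[j' j'r ->] : Y`_j \in [seq g j | j <- r] by rewrite mem_nth.
rewrite kg ?mem_head // ?inE ?j'r ?orbT //.
by case: eqP ir => [->|]; rewrite ?j'r ?mulr0.
Qed.

(** Induction on the weight of [v]: [y * e v] is a multiple of [e v] plus an element of [J e_v],
    which is a multiple of [al v] or a combination of arrows with coefficients cut down at vertices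
    of smaller weight. *)
Lemma rb_span (ps : seq (hpath T)) : (forall p, (p \in ps) = allowed p) ->
  (fullv <= <<[seq rb p | p <- ps]>>)%VS.
Proof.
move=> mem_ps; set V := <<_>>%VS.
have bV p : allowed p -> rb p \in V by move=> okp; rewrite memv_span // map_f ?mem_ps.
have bxV (x : harrow) y : hvalid x -> y \in V -> y * elt x \in V.
  move=> xok yV.
  have okx : @allowed T (hsrc x, [:: x]) by apply: allowed_arrow.
  have xE : rb (hsrc x, [:: x]) = elt x by rewrite /rb /=; case: (eltP xok).
  have mV p : allowed p -> rb p * elt x \in V.
    by move=> okp; rewrite -xE rb_mul //; case: ifP => [/andP[_ /bV]|] //; rewrite mem0v.
  have sV : (amulr (elt x) @: V <= V)%VS.
    rewrite limg_span; apply/span_subvP => z /mapP[_ /mapP[p + ->] ->].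
    by rewrite mem_ps lfunE /= => /mV.
  by apply: (subvP sV); have := memv_img (amulr (elt x)) yV; rewrite lfunE.
suff main v y : y * e v \in V.
  by apply/subvP => y _; rewrite -[y]mulr1 -(frame_sum FF) mulr_sumr memv_suml.
have [d] := ubnP (wt v); elim: d v y => // d IHd v y; rewrite ltnS => dv.
rewrite -[y * e v](subrK (f v y *: e v)) memvD //; last first.
  by rewrite memvZ // (bV (v, [::])) // allowed_nil.
have -> : y * e v - f v y *: e v = (y * e v - f v y *: e v) * e v.
  by rewrite mulrBl -mulrA -scalerAl (frame_idem FF).
have jJ := frame_corner FF v y.
have [vD|vD] := boolP (v \in D).
  have [l ->] := al_gen vD jJ; rewrite memvZ //.
  have := bV (v, [:: inr v]); rewrite allowed_cons /= vD eqxx /rb /=.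
  by have [_ _ -> _] := alP vD; apply.
have [c ->] := el_gen vD jJ; rewrite memv_suml // => a /eqP av.
have [_ ea _] := elP a; rewrite -ea mulrA.
apply: (bxV (inl a)) => //.
by apply: IHd; apply: leq_trans dv; rewrite -av wt_arrow.
Qed.

Lemma rtriple_iso : iso_kT T L.
Proof.
have [ps [ps_uniq mem_ps]] := allowed_enum; exists rb, ps; split=> //; split=> //.
split; last exact: rb_mul.
rewrite /basis_of eqEsubv subvf rb_span //=.
have [kap [kl kb]] := dual_path_basis; apply: (free_dual (kap := kap)) => // p q.
by rewrite !mem_ps; apply: kb.
Qed.

End Reconstruction.

(** Choosing a basis of each [J e_v] that has one, and a spanning vector of each remaining [J e_v],
    yields the data of the preceding reconstruction. *)
Lemma condF_triple (k : fieldType) (L : falgType k) n f e J :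
  @frame k L n f e J -> condF L -> exists T, triple_ok T /\ iso_kT T L.
Proof.
move=> FF FL; pose based v := exists m t a, @rad_basis k L n e J v m t a.
pose D := [set v | ~~ `[< based v >]].
have inD v : v \in D -> ~ based v by rewrite inE => /asboolPn.
have outD v : v \notin D -> based v by rewrite inE negbK => /asboolP.
(* On [D] the chosen family is empty, so no old arrow starts there. *)
have /choice[rb rbP] : forall v, exists r : {m & (('I_m -> 'I_n) * ('I_m -> L))%type},
    (v \notin D -> rad_basis e J v (tagged r).1 (tagged r).2) /\ (v \in D -> tag r = 0%N).
  move=> v; have [vD|vD] := boolP (v \in D).
    by exists (existT _ 0%N ((fun=> v), (fun=> 0))).
  by have [m [t [a rba]]] := outD v vD; exists (existT _ m (t, a)).
pose m v := tag (rb v); pose t v := (tagged (rb v)).1; pose a v := (tagged (rb v)).2.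
have rba v : v \notin D -> rad_basis e J v (t v) (a v) by case: (rbP v).
pose A := {v : 'I_n & 'I_(m v)}; pose ev (i : 'I_#|{: A}|) : A := enum_val i.
pose src i := tag (ev i); pose tgt i := t _ (tagged (ev i)).
pose el i := a _ (tagged (ev i)).
have srcD i : src i \notin D.
  apply/negP => /(rbP _).2; rewrite /src; case: (ev i) => v [j lt_j] /= mv.
  by move: lt_j; rewrite /m mv.
have sumA v (F : A -> L) :
    \sum_(i | src i == v) F (ev i) = \sum_(j < m v) F (existT _ v j).
  have <- : \sum_(u | u == v) \sum_(j < m u) F (existT _ u j) =
      \sum_(j < m v) F (existT _ v j) by rewrite big_pred1_eq.
  rewrite (sig_big_dep (J := fun u => 'I_(m u)) _ (fun u j => true)
    (fun u j => F (existT _ u j))) /=.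
  rewrite [RHS](reindex ev) /=; last exact/onW_bij/enum_val_bij.
  by apply: eq_big => i; rewrite ?andbT // /src; case: (ev i).
have /choice[ra raP] : forall d, exists r : 'I_n * L, d \in D ->
    [/\ r.2 \in J, r.2 != 0, e r.1 * r.2 = r.2, r.2 * e d = r.2 &
    (forall y, y \in J -> y * r.2 = 0) /\
    forall y, y \in J -> exists l : k, y * e d = l *: r.2].
  move=> d; have [dD|_] := boolP (d \in D); last by exists (d, 0).
  have [/(proj_sub_rad_basis FF)/(inD d dD)//|] := vertex_condF FF d FL.
  by move=> /(simple_sub_rad_line FF)[w [x wx]]; exists (w, x).
pose rho d := (ra d).1; pose al d := (ra d).2.
have elP i : [/\ el i \in J, e (tgt i) * el i = el i & el i * e (src i) = el i].
  by have [elP _ _] := rba _ (srcD i); apply: elP.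
have el_gen v y : v \notin D -> y \in J ->
    exists c : 'I_#|{: A}| -> L, y * e v = \sum_(i | src i == v) c i * el i.
  move=> vD yJ; have [_ gen _] := rba _ vD; have [c ->] := gen y yJ.
  (* Passing through natural numbers avoids a cast between the index types of [v] and [src i]; the
     default [0] only occurs for numbers out of range. *)
  pose c' j := if insub j is Some j' then c j' else 0.
  exists (fun i => c' (tagged (ev i))).
  rewrite (sumA v (fun p : A => c' (tagged p) * a _ (tagged p))) /=.
  by apply: eq_bigr => j _; rewrite /c' valK.
have el_free v (c : 'I_#|{: A}| -> L) : \sum_(i | src i == v) c i * el i = 0 ->
    forall i, src i = v -> c i * e (tgt i) = 0.
  move=> + i iv; rewrite -{v}iv => c0; have [_ _ fr] := rba _ (srcD i).
  have := fr (fun j => c (enum_rank (existT _ (src i) j : A))) _ (tagged (ev i)).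
  rewrite /src -(sumA _ (fun p : A => c (enum_rank p) * a _ (tagged p))).
  rewrite (_ : existT _ _ _ = ev i) ?enum_valK; last by case: (ev i).
  apply; rewrite -[RHS]c0; apply: eq_bigr => j _.
  by rewrite enum_valK.
have alP d : d \in D ->
    [/\ al d \in J, al d != 0, e (rho d) * al d = al d & al d * e d = al d].
  by move=> /raP[].
have rad_al d y : d \in D -> y \in J -> y * al d = 0.
  by move=> /raP[_ _ _ _ [H _]]; apply: H.
have al_gen d y : d \in D -> y \in J -> exists l : k, y * e d = l *: al d.
  by move=> /raP[_ _ _ _ [_ H]]; apply: H.
(* If no arrow left [rho d], then [J e_(rho d)] would vanish and [J e_d] would have a basis,
   contrary to the choice of [D]. *)
have rho_sink d : d \in D -> rho d \notin D -> exists i, src i = rho d.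
  move=> dD rD; apply: contrapT => nsrc; apply: (inD d dD).
  apply: (rad_basis_simple FF (alP d dD)) => [y yJ|y yJ]; first exact: al_gen.
  have [c ->] := el_gen _ _ rD yJ; rewrite big1 // => i /eqP ir.
  by case: nsrc; exists i.
exists (rtriple src tgt D rho); split.
  exact: (rtriple_ok FF srcD elP el_free rho_sink).
exact: (rtriple_iso FF srcD elP el_gen el_free alP rad_al al_gen).
Qed.

(** * Uniqueness *)

(** An element is sent to the one at the same position in the enumeration of the corresponding
    fibre. *)
Lemma fibre_injection (A B : finType) (C : eqType) (s : A -> C) (t : B -> C) :
  (forall c, #|[pred a | s a == c]| = #|[pred b | t b == c]|) ->
  exists2 h : A -> B, injective h & forall a, t (h a) = s a.
Proof.
move=> cardE'; pose EA c := enum [pred a | s a == c]; pose EB c := enum [pred b | t b == c].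
have /choice[h hP] : forall a, exists b,
    b \in EB (s a) /\ index b (EB (s a)) = index a (EA (s a)).
  move=> a; have lt_a : (index a (EA (s a)) < size (EB (s a)))%N.
    by rewrite -cardE -cardE' cardE index_mem mem_enum inE.
  have b0 : B by case: (EB (s a)) lt_a.
  exists (nth b0 (EB (s a)) (index a (EA (s a)))).
  by rewrite mem_nth // index_uniq // enum_uniq.
have th a : t (h a) = s a by have [+ _] := hP a; rewrite mem_enum inE => /eqP.
exists h => // a a' hE; have sE : s a = s a' by rewrite -!th hE.
have [[_ Ea] [_ Ea']] := (hP a, hP a').
rewrite sE in Ea; have inEA x : s x = s a' -> x \in EA (s a').
  by move=> xa; rewrite mem_enum inE xa.
by rewrite -[LHS](nth_index a' (inEA a sE)) -Ea hE Ea' nth_index ?inEA.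
Qed.

Lemma fibre_bijection (A B : finType) (C : eqType) (s : A -> C) (t : B -> C) :
  (forall c, #|[pred a | s a == c]| = #|[pred b | t b == c]|) ->
  exists2 h : A -> B, bijective h & forall a, t (h a) = s a.
Proof.
move=> cardE'; have [h hinj th] := fibre_injection cardE'.
have [g ginj _] := fibre_injection (fun c => esym (cardE' c)).
by exists h => //; apply: inj_card_bij (leq_card g ginj).
Qed.

Section TwoFrames.
Variables (k : fieldType) (L : falgType k).

(** The character [chi] kills the nilpotent elements of [J] and is nonzero on some [e v]; applying
    it to [x * e v], congruent to [f v x *: e v] modulo [J], gives [chi x = f v x]. *)
Lemma frame_character n f e J (chi : L -> k) : @frame k L n f e J ->
  (forall (a : k) x y, chi (a *: x + y) = a * chi x + chi y) ->
  (forall x y, chi (x * y) = chi x * chi y) -> chi 1 = 1 ->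
  exists v, chi =1 f v.
Proof.
move=> FF lin chiM chi1.
have chi0 : chi 0 = 0 by have := lin (-1) 0 0; rewrite scaler0 addr0 mulN1r addNr.
have chiD x y : chi (x + y) = chi x + chi y by have := lin 1 x y; rewrite scale1r mul1r.
have chiZ a x : chi (a *: x) = a * chi x by rewrite -[_ *: _]addr0 lin chi0 addr0.
have chiJ x : x \in J -> chi x = 0.
  move=> /(frame_rad_nil FF)[N xN]; have chiX m : chi (x ^+ m) = chi x ^+ m.
    by elim: m => [|m IH]; rewrite ?expr0 // !exprS chiM IH.
  by apply/eqP; have := chiX N; rewrite xN chi0 => /esym/eqP; rewrite expf_eq0 => /andP[].
have [v chiv] : exists v, chi (e v) != 0.
  apply: contrapT => H; have /eqP := chi1; rewrite -(frame_sum FF).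
  rewrite (big_morph chi chiD chi0) big1 ?(eq_sym 0) ?oner_eq0 // => v _.
  by apply/eqP; apply: contrapT => /negP chiv; apply: H; exists v.
exists v => x; apply: (mulIf chiv); apply/eqP.
rewrite -chiM -chiZ -subr_eq0 -mulN1r -chiZ scaleN1r -chiD.
by rewrite chiJ ?(frame_corner FF).
Qed.

Variables (n : nat) (f : 'I_n -> L -> k) (e : 'I_n -> L) (J : {vspace L}).
Variables (n' : nat) (f' : 'I_n' -> L -> k) (e' : 'I_n' -> L) (J' : {vspace L}).
Hypotheses (FF : frame f e J) (FF' : frame f' e' J').

(** Each frame lists all characters of [L], so the lists match, and with them their common
    kernels. *)
Lemma frame_bijection : exists phi : 'I_n -> 'I_n',
  [/\ bijective phi, J' = J & forall v, e' (phi v) - e v \in J].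
Proof.
have /choice[phi phiP] : forall v, exists v', f v =1 f' v'.
  move=> v; apply: (frame_character FF').
  - exact: (frame_lin FF).
  - exact: (frameM FF).
  exact: (frame1 FF).
have /choice[psi psiP] : forall v', exists v, f' v' =1 f v.
  move=> v; apply: (frame_character FF).
  - exact: (frame_lin FF').
  - exact: (frameM FF').
  exact: (frame1 FF').
have bij : bijective phi.
  exists psi => v; apply/eqP.
    have := frame_char FF (psi (phi v)) v; rewrite -psiP -phiP (frame_char FF) eqxx.
    by case: eqP => // _ /eqP; rewrite oner_eq0.
  have := frame_char FF' (phi (psi v)) v; rewrite -phiP -psiP (frame_char FF') eqxx.
  by case: eqP => // _ /eqP; rewrite oner_eq0.
exists phi; split=> // [|v].
  apply/vspaceP => x; apply/idP/idP.
    move=> /(frame_radP FF' x) fx; apply/(frame_radP FF x) => v.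
    by rewrite phiP.
  move=> /(frame_radP FF x) fx; apply/(frame_radP FF' x) => v.
  by rewrite psiP.
apply/(frame_radP FF) => u; rewrite (frameB FF) phiP (frame_char FF') (frame_char FF).
by rewrite (bij_eq bij) subrr.
Qed.

Let Jr : (J * fullv <= J)%VS.
Proof. by apply/prodvP => x y xJ _; apply: (frame_rad_mulr FF). Qed.

Let Jl : (fullv * J <= J)%VS.
Proof. by apply/prodvP => x y _ yJ; apply: (frame_rad_mull FF). Qed.

Let subJ (x y : L) : x - y \in J -> (<[x]> <= <[y]> + J)%VS.
Proof.
by move=> xy; rewrite -memvE -[x](subrK y) addrC memv_add ?memv_line.
Qed.

(** Changing the outer factors by elements of [J] changes the corner only within [J * J], so the
    corner does not depend on the choice of idempotents. *)
Lemma rad_corner_sub (x y z t : L) : x - y \in J -> z - t \in J ->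
  (J * J + <[x]> * J * <[z]> <= J * J + <[y]> * J * <[t]>)%VS.
Proof.
move=> /subJ xy /subJ zt; rewrite subv_add addvSl /=.
apply: subv_trans (prodvS (prodvSl J xy) zt) _.
rewrite prodvDl prodvDr !prodvDl !subv_add addvSr /=.
have JJ : (J * J <= J * J + <[y]> * J * <[t]>)%VS by apply: addvSl.
apply/andP; split; [|apply/andP; split]; apply: subv_trans JJ.
- by rewrite -prodvA prodvSr // (subv_trans (prodvSr _ (subvf _))).
- by rewrite prodvSl // (subv_trans (prodvSl _ (subvf _))).
by rewrite prodvSl // (subv_trans (prodvSl _ (subvf _))).
Qed.

Lemma rad_square_sub (x y : L) : x - y \in J ->
  (J * J * <[y]> <= J * J * J)%VS -> (J * J * <[x]> <= J * J * J)%VS.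
Proof.
move=> /subJ xy yJ; apply: subv_trans (prodvSr _ xy) _.
by rewrite prodvDr subv_add yJ /=.
Qed.

End TwoFrames.

(** * Old and new arrows of the full quiver *)

Section Arrows.
Variable T : triple.
Hypothesis okT : triple_ok T.
Local Notation G := (tG T).

Lemma arrows_from_D d w x : d \in tD T -> x \in arrows_between d w ->
  x = inr d /\ trho T d = w.
Proof.
move=> dD; rewrite inE; case: x => [a|d'] /and3P[_ /= /eqP ad /eqP].
  by have [_ [/(_ d dD)/forallP/(_ a)]] := okT; rewrite ad eqxx.
by rewrite ad.
Qed.

Lemma card_old_arrows v w :
  #|[pred a : 'I_(na G) | (qsrc a, qtgt a) == (v, w)]| =
  if v \in tD T then 0%N else #|arrows_between v w|.
Proof.
case: ifP => [vD|vD].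
  apply: eq_card0 => a; rewrite !inE xpair_eqE; apply/negP => /andP[av _].
  by have [_ [/(_ v vD)/forallP/(_ a)]] := okT; rewrite av.
rewrite -(card_imset _ (@inl_inj 'I_(na G) 'I_(nv G))); apply: eq_card => x.
rewrite inE; apply/imsetP/idP => [[a + ->]|].
  by rewrite inE xpair_eqE => /andP[-> ->].
case: x => [a|d] /and3P[/= aok /eqP av /eqP aw]; last by rewrite -av aok in vD.
by exists a; rewrite // inE av aw.
Qed.

End Arrows.

(** The bijection of characters preserves the number of arrows between two vertices and the
    characterization [mem_tD] of [D]. *)
Lemma triple_unique (k : fieldType) (L : falgType k) (T T' : triple) :
  triple_ok T -> triple_ok T' -> iso_kT T L -> iso_kT T' L -> triple_iso T T'.
Proof.
move=> okT okT' [b [ps [ups [mps [bas bM]]]]] [b' [ps' [ups' [mps' [bas' bM']]]]].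
have FF := path_frame ups mps bas bM; have FF' := path_frame ups' mps' bas' bM'.
have [phi [bij JJ ephi]] := frame_bijection FF FF'.
have card_phi v w : #|arrows_between (phi v) (phi w)| = #|arrows_between v w|.
  have := dim_rad_corner ups' mps' bas' bM' (phi v) (phi w).
  have := dim_rad_corner ups mps bas bM v w; rewrite JJ.
  set V := (_ + _)%VS; set V' := (_ + _)%VS => VE V'E.
  have EV : V = V'.
    apply: subv_anti; rewrite !(rad_corner_sub FF) ?ephi //.
      by rewrite -opprB memvN ephi.
    by rewrite -opprB memvN ephi.
  by move: V'E; rewrite -EV VE => /addnI.
have neq0 v w : (arrows_between (phi v) (phi w) != set0) = (arrows_between v w != set0).
  by rewrite -!card_gt0 card_phi.
have phiD v : (phi v \in tD T') = (v \in tD T).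
  have [psi _ psiK] := bij.
  apply/idP/idP.
    move=> /(mem_tD ups' mps' bas' bM' okT') [sub [w [u]]].
    rewrite -(psiK w) -(psiK u) !neq0 => wu.
    apply/(mem_tD ups mps bas bM okT); split; last by exists (psi w), (psi u).
    rewrite JJ in sub; apply: (rad_square_sub _ sub).
    by rewrite -opprB memvN ephi.
  move=> /(mem_tD ups mps bas bM okT) [sub [w [u wu]]].
  apply/(mem_tD ups' mps' bas' bM' okT'); split; last first.
    by exists (phi w), (phi u); rewrite !neq0.
  by rewrite JJ; apply: rad_square_sub sub; apply: ephi.
(* Arrows are matched within each pair of endpoints; those leaving [D] are all new and are not
   counted. *)
have [c|h hbij hE] := @fibre_bijection _ _ _
    (fun a : 'I_(na (tG T)) => (phi (qsrc a), phi (qtgt a)))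
    (fun a : 'I_(na (tG T')) => (qsrc a, qtgt a)).
  have [psi _ psiK] := bij; case: c => v w; rewrite -(psiK v) -(psiK w).
  rewrite (card_old_arrows okT') phiD card_phi -(card_old_arrows okT).
  by apply: eq_card => a; rewrite !inE !xpair_eqE !(bij_eq bij).
exists phi, h; split=> //; split=> //; split; first by move=> a; have [] := hE a.
split; first by move=> a; have [] := hE a.
split.
  have [psi _ psiK] := bij; apply/setP => v; apply/imsetP/idP => [[d dD ->]|vD].
    by rewrite phiD.
  by exists (psi v); rewrite ?psiK // -phiD psiK.
(* Equality of arrow numbers gives an arrow from [phi d] to [phi (rho d)]; as [phi d] is in the
   second set [D], it can only be the new arrow there. *)
move=> d dD; have /set0Pn[x xd] : arrows_between (phi d) (phi (trho T d)) != set0.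
  by rewrite neq0; apply/set0Pn; exists (inr d); rewrite inE /= dD !eqxx.
by have [] := arrows_from_D okT' _ xd; rewrite ?phiD.
Qed.

Theorem theorem3p7 (k : fieldType) :
  (forall L : falgType k, elementary L ->
     (condF L <-> exists T : triple, triple_ok T /\ iso_kT T L)) /\
  (forall T T' : triple, triple_ok T -> triple_ok T' ->
     (exists L : falgType k, iso_kT T L /\ iso_kT T' L) ->
     triple_iso T T').
Proof.
split=> [L elemL|T T' okT okT' [L [isoT isoT']]]; last exact: triple_unique isoT isoT'.
split=> [FL|[T [okT [b [ps [ups [mps [bas bM]]]]]]]]; last first.
  exact: path_condF ups mps bas bM okT.
have [n [f [e [J FF]]]] := elementary_frame elemL.
exact: condF_triple FF FL.
Qed.
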